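(* Assume $T$ is NIP. For tuples $a,b$ and a parameter set $A$, $$\mathrm{opD}(a,b/A)\le\mathrm{opD}(a/A)+\mathrm{opD}(b/A\cup\{a\}).$$
   Context: $T$ complete with monster $\mathbb{U}$, NIP. $\phi^1=\phi,\phi^0=\neg\phi$. op-rank: for $0<n<\omega$, partial type $\pi(x)$, finite set $\Delta$ of formulas $\phi(x,y)$ with parameters: $\mathrm{opR}_n(\pi,\Delta)\ge0$ if $\pi$ consistent; limits as usual; $\mathrm{opR}_n(\pi,\Delta)\ge\alpha+1$ iff there are instances $\phi_0(x,a_0),\dots,\phi_{n-1}(x,a_{n-1})$ from $\Delta$ with $\mathrm{opR}_n(\pi\cup\{\bigwedge_{i<n}\phi_i(x,a_i)^{\sigma(i)}\},\Delta)\ge\alpha$ for all $\sigma\in2^n$; $\infty$ means $\ge$ all ordinals. $\mathrm{opD}(\pi)=\sup\{0<n<\omega:\exists\Delta\ \mathrm{opR}_n(\pi,\Delta)=\infty\}\le\omega$ ($\sup\emptyset=0$), and $\mathrm{opD}(c/B)=\mathrm{opD}(\mathrm{tp}(c/B))$. *)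

(* Defs.v *)
(* first-order model theory developed from scratch.
   Formulas use de Bruijn indices; an assignment is a list of elements
   (variable k denotes the k-th entry).  Formulas may contain parameters
   (elements of the structure) as constants. *)
From Stdlib Require Import List Arith PeanoNat ClassicalEpsilon.
Import ListNotations.
Set Implicit Arguments.

Record language := {
  Fun : Type; fun_ar : Fun -> nat;
  Rel : Type; rel_ar : Rel -> nat }.

Record structure (L : language) := {
  dom :> Type;
  ifun : Fun L -> list dom -> dom;   (* only used on lists of the right arity *)
  irel : Rel L -> list dom -> Prop }.

Section Syntax.
Variable L : language.
Variable D : Type.

Inductive term : Type :=
| Var : nat -> term
| Par : D -> term
| App : Fun L -> list term -> term.

Inductive formula : Type :=
| FTrue | FFalse
| FEq : term -> term -> formula
| FRel : Rel L -> list term -> formula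
| FNot : formula -> formula
| FAnd : formula -> formula -> formula
| FOr : formula -> formula -> formula
| FImp : formula -> formula -> formula
| FEx : formula -> formula      (* binds de Bruijn index 0 *)
| FAll : formula -> formula.

Fixpoint tbound (k : nat) (t : term) : Prop :=
  match t with
  | Var i => i < k
  | Par _ => True
  | App _ ts => (fix go l := match l with nil => True | t :: l => tbound k t /\ go l end) ts
  end.

Fixpoint fbound (k : nat) (p : formula) : Prop :=
  match p with
  | FTrue | FFalse => True
  | FEq t1 t2 => tbound k t1 /\ tbound k t2
  | FRel _ ts => Forall (tbound k) ts
  | FNot q => fbound k q
  | FAnd q r | FOr q r | FImp q r => fbound k q /\ fbound k r
  | FEx q | FAll q => fbound (S k) q
  end.

Fixpoint tparams (B : D -> Prop) (t : term) : Prop :=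
  match t with
  | Var _ => True
  | Par v => B v
  | App _ ts => (fix go l := match l with nil => True | t :: l => tparams B t /\ go l end) ts
  end.

Fixpoint fparams (B : D -> Prop) (p : formula) : Prop :=
  match p with
  | FTrue | FFalse => True
  | FEq t1 t2 => tparams B t1 /\ tparams B t2
  | FRel _ ts => Forall (tparams B) ts
  | FNot q => fparams B q
  | FAnd q r | FOr q r | FImp q r => fparams B q /\ fparams B r
  | FEx q | FAll q => fparams B q
  end.

(* substitution of the parameter tuple a for the variables nx, nx+1, ...
   (at binder depth d): this turns phi(x,y) into phi(x,a) *)
Fixpoint tsubst (nx : nat) (a : list D) (d : nat) (t : term) : term :=
  match t with
  | Var k => if k <? d + nx then Var k
             else match nth_error a (k - (d + nx)) with
                  | Some v => Par v | None => Var k end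
  | Par v => Par v
  | App f ts => App f (map (tsubst nx a d) ts)
  end.

Fixpoint fsubst (nx : nat) (a : list D) (d : nat) (p : formula) : formula :=
  match p with
  | FTrue => FTrue | FFalse => FFalse
  | FEq t1 t2 => FEq (tsubst nx a d t1) (tsubst nx a d t2)
  | FRel r ts => FRel r (map (tsubst nx a d) ts)
  | FNot q => FNot (fsubst nx a d q)
  | FAnd q r => FAnd (fsubst nx a d q) (fsubst nx a d r)
  | FOr q r => FOr (fsubst nx a d q) (fsubst nx a d r)
  | FImp q r => FImp (fsubst nx a d q) (fsubst nx a d r)
  | FEx q => FEx (fsubst nx a (S d) q)
  | FAll q => FAll (fsubst nx a (S d) q)
  end.

Definition instance (nx : nat) (phi : formula) (a : list D) : formula :=
  fsubst nx a 0 phi.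

Fixpoint bigand (l : list formula) : formula :=
  match l with
  | nil => FTrue
  | [p] => p
  | p :: l => FAnd p (bigand l)
  end.

Definition fpow (p : formula) (b : bool) : formula := if b then p else FNot p.

End Syntax.

Arguments Var {L D}. Arguments Par {L D}. Arguments FTrue {L D}. Arguments FFalse {L D}.

Section Semantics.
Variable L : language.
Variable M : structure L.

Fixpoint teval (rho : list M) (t : term L M) : option M :=
  match t with
  | Var k => nth_error rho k
  | Par v => Some v
  | App f ts =>
      match (fix go l := match l with
                         | nil => Some nil
                         | t :: l => match teval rho t, go l with
                                     | Some v, Some vs => Some (v :: vs)
                                     | _, _ => None end end) ts with
      | Some vs => if length vs =? fun_ar L f then Some (@ifun L M f vs) else None
      | None => None
      end
  end.

Fixpoint tevals (rho : list M) (ts : list (term L M)) : option (list M) :=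
  match ts with
  | nil => Some nil
  | t :: l => match teval rho t, tevals rho l with
              | Some v, Some vs => Some (v :: vs)
              | _, _ => None end
  end.

(* satisfaction M |= p[rho]; ill-scoped/ill-formed atoms are false
   (irrelevant for the well-scoped formulas used below) *)
Fixpoint sat (rho : list M) (p : formula L M) : Prop :=
  match p with
  | FTrue => True
  | FFalse => False
  | FEq t1 t2 => exists v, teval rho t1 = Some v /\ teval rho t2 = Some v
  | FRel r ts => exists vs, tevals rho ts = Some vs /\ length vs = rel_ar L r /\ @irel L M r vs
  | FNot q => ~ sat rho q
  | FAnd q r => sat rho q /\ sat rho r
  | FOr q r => sat rho q \/ sat rho r
  | FImp q r => sat rho q -> sat rho r
  | FEx q => exists v, sat (v :: rho) q
  | FAll q => forall v, sat (v :: rho) q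
  end.

Definition pfree (p : formula L M) : Prop := fparams (fun _ => False) p.

Definition small (K : Type) (B : M -> Prop) : Prop :=
  ~ exists g : K -> M, (forall k1 k2, g k1 = g k2 -> k1 = k2) /\ forall k, B (g k).

Definition ptype := formula L M -> Prop.

Definition consistent (nx : nat) (pi : ptype) : Prop :=
  forall l : list (formula L M), (forall p, In p l -> pi p) ->
    exists c : list M, length c = nx /\ forall p, In p l -> sat c p.

Definition kappa_saturated (K : Type) : Prop :=
  forall (B : M -> Prop) (nx : nat) (pi : ptype), small K B ->
    (forall p, pi p -> fbound nx p /\ fparams B p) ->
    consistent nx pi ->
    exists c : list M, length c = nx /\ forall p, pi p -> sat c p.

Definition automorphism (g : M -> M) : Prop :=
  (forall x y, g x = g y -> x = y) /\ (forall y, exists x, g x = y) /\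
  (forall f vs, length vs = fun_ar L f -> g (@ifun L M f vs) = @ifun L M f (map g vs)) /\
  (forall r vs, length vs = rel_ar L r -> (@irel L M r vs <-> @irel L M r (map g vs))).

Definition elementary_on (B : M -> Prop) (f : M -> M) : Prop :=
  forall (c : list M) (p : formula L M), Forall B c -> pfree p -> fbound (length c) p ->
    (sat c p <-> sat (map f c) p).

Definition strongly_homogeneous (K : Type) : Prop :=
  forall (B : M -> Prop) (f : M -> M), small K B -> elementary_on B f ->
    exists g, automorphism g /\ forall x, B x -> g x = f x.

(* M is a monster model: kappa-saturated and strongly kappa-homogeneous,
   for an infinite kappa = |K| with kappa > |T| = |L| + aleph_0 *)
Definition monster (K : Type) : Prop :=
  inhabited M /\
  (exists g : nat -> K, forall n m, g n = g m -> n = m) /\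
  (~ exists g : K -> (nat + Fun L + Rel L)%type, forall k1 k2, g k1 = g k2 -> k1 = k2) /\
  kappa_saturated K /\ strongly_homogeneous K.

Definition NIP : Prop :=
  forall (n m : nat) (phi : formula L M), pfree phi -> fbound (n + m) phi ->
    exists N : nat, ~ exists a : nat -> list M,
      (forall i, i < N -> length (a i) = n) /\
      forall S : nat -> bool, exists b : list M, length b = m /\
        forall i, i < N -> (sat (a i ++ b) phi <-> S i = true).

(* Delta: a finite set (list) of formulas phi(x,y), each given with the length
   m of its tuple y; phi has free variables among x (0..nx-1) and y (nx..nx+m-1). *)
Definition fset_Delta := list (nat * formula L M).

Definition wf_Delta (nx : nat) (Delta : fset_Delta) : Prop :=
  forall m p, In (m, p) Delta -> fbound (nx + m) p.

Definition add_formula (pi : ptype) (q : formula L M) : ptype :=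
  fun p => pi p \/ p = q.

(* rank_ge W R nx n Delta w pi  means  opR_n(pi, Delta) >= rank_R(w)
   (ordinals represented by elements of well-founded relations):
   pi is consistent, and for every v below w there are instances
   phi_0(x,a_0),...,phi_{n-1}(x,a_{n-1}) from Delta such that all
   pi + {/\_i phi_i(x,a_i)^sigma(i)} (sigma in 2^n) have rank >= v. *)
Inductive rank_ge (W : Type) (R : W -> W -> Prop) (nx n : nat) (Delta : fset_Delta)
  : W -> ptype -> Prop :=
| rank_ge_intro : forall (w : W) (pi : ptype),
    consistent nx pi ->
    (forall v, R v w ->
       exists (phis : nat -> nat * formula L M) (a : nat -> list M),
         (forall i, i < n -> In (phis i) Delta /\ length (a i) = fst (phis i)) /\
         forall sigma : nat -> bool,
           rank_ge R nx n Delta v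
             (add_formula pi
                (bigand (map (fun i => fpow (instance nx (snd (phis i)) (a i)) (sigma i))
                             (seq 0 n))))) ->
    rank_ge R nx n Delta w pi.

Definition opR_inf (nx n : nat) (Delta : fset_Delta) (pi : ptype) : Prop :=
  forall (W : Type) (R : W -> W -> Prop), well_founded R -> forall w, rank_ge R nx n Delta w pi.

(* enat: Some k = k, None = omega *)
Definition enat := option nat.
Definition enat_le (d e : enat) : Prop :=
  match d, e with
  | _, None => True
  | None, Some _ => False
  | Some i, Some j => i <= j
  end.
Definition enat_add (d e : enat) : enat :=
  match d, e with
  | Some i, Some j => Some (i + j)
  | _, _ => None
  end.
Definition is_sup (P : nat -> Prop) (d : enat) : Prop :=
  (forall k, P k -> enat_le (Some k) d) /\
  (forall e, (forall k, P k -> enat_le (Some k) e) -> enat_le d e).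

Definition opD_set (nx : nat) (pi : ptype) (k : nat) : Prop :=
  0 < k /\ exists Delta, wf_Delta nx Delta /\ opR_inf nx k Delta pi.

(* opD(pi) = sup { 0 < n < omega : exists Delta, opR_n(pi,Delta) = infinity }, sup {} = 0 *)
Definition opD (nx : nat) (pi : ptype) : enat :=
  epsilon (inhabits None) (is_sup (opD_set nx pi)).

Definition tp (c : list M) (B : M -> Prop) : ptype :=
  fun p => fbound (length c) p /\ fparams B p /\ sat c p.

Definition opD_tp (c : list M) (B : M -> Prop) : enat := opD (length c) (tp c B).

End Semantics.

(* Main.v *)
(* Two instances on the two sides of a first one can be glued along it into a single
   instance, so an infinite binary tree of instances already gives infinite op-rank for every n:
   opD takes only the values 0 and omega, and the inequality says that if tp(a/A) and tp(b/Aa)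
   carry no infinite binary tree then neither does tp(ab/A). By compactness some formula
   theta(x,y) in tp(ab/A) has, over every x in a set of tp(a/A), a fibre without trees of height r.
   Induct on r. At a node z of a tree over theta, discard from each side the points whose fibre
   has no tree of height r - 1 on that side; by induction this costs a bounded height. For the
   remaining points, which side of z they lie on is decided by the formula
   psi(x,z) = "the fibre over x has a tree of height r - 1 on the positive side of z", so the tree
   projects to a tree of instances of psi in tp(a/A), whose height is bounded. *)
Require Import Defs.
From Stdlib Require Import List Arith Lia Classical ClassicalEpsilon.
Import ListNotations.
Set Implicit Arguments.

(** * Substitution of atoms *)

Section Substitution.
Variable L : language.
Variable D : Type.

(* [inl k] stands for the variable [k], [inr v] for the parameter [v]. *)
Definition atom := (nat + D)%type.

Definition term_of (x : atom) : term L D :=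
  match x with inl k => Var k | inr v => Par v end.

Definition shift (x : atom) : atom :=
  match x with inl k => inl (S k) | inr v => inr v end.

Definition lift (s : atom -> atom) (x : atom) : atom :=
  match x with
  | inl 0 => inl 0
  | inl (S k) => shift (s (inl k))
  | inr v => shift (s (inr v))
  end.

Fixpoint tmap (s : atom -> atom) (t : term L D) : term L D :=
  match t with
  | Var k => term_of (s (inl k))
  | Par v => term_of (s (inr v))
  | App f ts => App f (map (tmap s) ts)
  end.

(** One simultaneous substitution serves three purposes: inserting parameters for variables, turning
    parameters into variables, and rearranging variables. *)
Fixpoint fmap (s : atom -> atom) (p : formula L D) : formula L D :=
  match p with
  | FTrue => FTrue | FFalse => FFalse
  | FEq t1 t2 => FEq (tmap s t1) (tmap s t2)
  | FRel r ts => FRel r (map (tmap s) ts)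
  | FNot q => FNot (fmap s q)
  | FAnd q r => FAnd (fmap s q) (fmap s r)
  | FOr q r => FOr (fmap s q) (fmap s r)
  | FImp q r => FImp (fmap s q) (fmap s r)
  | FEx q => FEx (fmap (lift s) q)
  | FAll q => FAll (fmap (lift s) q)
  end.

Definition atom_in (n : nat) (B : D -> Prop) (x : atom) : Prop :=
  match x with inl k => k < n | inr v => B v end.

(** The generated induction principle gives no hypothesis on the arguments of [App], which sit in a
    nested list. *)
Lemma nested_term_ind (P : term L D -> Prop) :
  (forall k, P (Var k)) -> (forall v, P (Par v)) ->
  (forall f ts, Forall P ts -> P (App f ts)) -> forall t, P t.
Proof.
  intros HV HP HA. fix IH 1. intros [k|v|f ts].
  - apply HV.
  - apply HP.
  - apply HA. induction ts as [|t ts IHts]; constructor; auto.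
Qed.

Lemma tbound_App k f (ts : list (term L D)) :
  tbound k (App f ts) <-> Forall (tbound k) ts.
Proof.
  induction ts as [|t ts IH]; simpl in *.
  - split; auto.
  - rewrite Forall_cons_iff. tauto.
Qed.

Lemma tparams_App B f (ts : list (term L D)) :
  tparams B (App f ts) <-> Forall (tparams B) ts.
Proof.
  induction ts as [|t ts IH]; simpl in *.
  - split; auto.
  - rewrite Forall_cons_iff. tauto.
Qed.

Lemma tmap_in s n B n' B' t :
  (forall x, atom_in n B x -> atom_in n' B' (s x)) ->
  tbound n t -> tparams B t -> tbound n' (tmap s t) /\ tparams B' (tmap s t).
Proof.
  intros Hs. induction t as [k|v|f ts IH] using nested_term_ind.
  - intros H _. specialize (Hs (inl k) H). simpl. destruct (s (inl k)); simpl in *; auto.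
  - intros _ H. specialize (Hs (inr v) H). simpl. destruct (s (inr v)); simpl in *; auto.
  - rewrite tbound_App, tparams_App. intros H1 H2.
    change (tmap s (App f ts)) with (App f (map (tmap s) ts)).
    rewrite tbound_App, tparams_App, !Forall_map.
    rewrite !Forall_forall in *. split; intros t Ht; apply IH; auto.
Qed.

Lemma lift_in s n B n' B' :
  (forall x, atom_in n B x -> atom_in n' B' (s x)) ->
  forall x, atom_in (S n) B x -> atom_in (S n') B' (lift s x).
Proof.
  intros Hs [[|k]|v] H; simpl in *; [lia| |].
  - specialize (Hs (inl k)). destruct (s (inl k)); simpl in *.
    + enough (n0 < n') by lia. apply Hs. lia.
    + apply Hs. lia.
  - specialize (Hs (inr v)). destruct (s (inr v)); simpl in *; auto.
    enough (n0 < n') by lia. auto.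
Qed.

Lemma fmap_in p : forall s n B n' B',
  (forall x, atom_in n B x -> atom_in n' B' (s x)) ->
  fbound n p -> fparams B p -> fbound n' (fmap s p) /\ fparams B' (fmap s p).
Proof.
  induction p as [| |t1 t2|r ts|q IH|q IHq r IHr|q IHq r IHr|q IHq r IHr|q IH|q IH];
    intros s n B n' B' Hs Hb Hp; simpl in *; auto.
  - destruct (@tmap_in s n B n' B' t1 Hs), (@tmap_in s n B n' B' t2 Hs); tauto.
  - rewrite !Forall_map. rewrite !Forall_forall in *.
    split; intros t Ht; apply (@tmap_in s n B n' B' t Hs); auto.
  - exact (IH s n B n' B' Hs Hb Hp).
  - destruct (IHq s n B n' B' Hs), (IHr s n B n' B' Hs); tauto.
  - destruct (IHq s n B n' B' Hs), (IHr s n B n' B' Hs); tauto.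
  - destruct (IHq s n B n' B' Hs), (IHr s n B n' B' Hs); tauto.
  - exact (IH _ _ _ _ _ (@lift_in s n B n' B' Hs) Hb Hp).
  - exact (IH _ _ _ _ _ (@lift_in s n B n' B' Hs) Hb Hp).
Qed.

Lemma tparams_mono (P Q : D -> Prop) : (forall v, P v -> Q v) ->
  forall t : term L D, tparams P t -> tparams Q t.
Proof.
  intros HPQ t. induction t as [| |g us IHu] using nested_term_ind; simpl; auto.
  change (tparams P (App g us) -> tparams Q (App g us)).
  rewrite !tparams_App, !Forall_forall in *. auto.
Qed.

Lemma tparams_finite (t : term L D) : exists l, tparams (fun v => In v l) t.
Proof.
  induction t as [k|v|f ts IH] using nested_term_ind.
  - exists []. exact I.
  - exists [v]. simpl. auto.
  - enough (exists l, Forall (tparams (fun v => In v l)) ts) as [l Hl].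
    { exists l. now apply tparams_App. }
    induction IH as [|t ts [l1 H1] _ [l2 H2]].
    + exists []. constructor.
    + exists (l1 ++ l2). constructor.
      * revert H1. apply tparams_mono. intros; apply in_or_app; auto.
      * eapply Forall_impl; [|exact H2]. intros u. apply tparams_mono.
        intros; apply in_or_app; auto.
Qed.

Lemma fparams_mono (P Q : D -> Prop) : (forall v, P v -> Q v) ->
  forall p : formula L D, fparams P p -> fparams Q p.
Proof.
  intros HPQ p. pose proof (@tparams_mono P Q HPQ).
  induction p; simpl; intuition. eapply Forall_impl; eauto.
Qed.

(** A formula mentions finitely many elements, so its parameters can be added to a small set without
    losing smallness. *)
Lemma fparams_finite (p : formula L D) : exists l, fparams (fun v => In v l) p.
Proof.
  assert (Hap : forall l1 l2 (q r : formula L D), fparams (fun v => In v l1) q ->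
    fparams (fun v => In v l2) r ->
    fparams (fun v => In v (l1 ++ l2)) q /\ fparams (fun v => In v (l1 ++ l2)) r).
  { intros l1 l2 q r H1 H2. split; [revert H1|revert H2]; apply fparams_mono;
      intros; apply in_or_app; auto. }
  induction p as [| |t1 t2|r ts|q IH|q IHq r IHr|q IHq r IHr|q IHq r IHr|q IH|q IH];
    simpl; try (destruct IHq as [l1 H1], IHr as [l2 H2]; exists (l1 ++ l2); now apply Hap);
    auto.
  - exists []. exact I.
  - exists []. exact I.
  - destruct (tparams_finite t1) as [l1 H1], (tparams_finite t2) as [l2 H2].
    exists (l1 ++ l2). split; [revert H1|revert H2]; apply tparams_mono;
      intros; apply in_or_app; auto.
  - induction ts as [|t ts [l2 H2]].
    + exists []. constructor.
    + destruct (tparams_finite t) as [l1 H1]. exists (l1 ++ l2). constructor.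
      * revert H1. apply tparams_mono. intros; apply in_or_app; auto.
      * eapply Forall_impl; [|exact H2]. intros u. apply tparams_mono.
        intros; apply in_or_app; auto.
Qed.

Lemma fparams_True (p : formula L D) : fparams (fun _ => True) p.
Proof. destruct (fparams_finite p) as [l Hl]. revert Hl. apply fparams_mono. auto. Qed.

End Substitution.

(** * Satisfaction under substitution of atoms *)

Section Evaluation.
Variable L : language.
Variable M : structure L.

Definition aval (rho : list M) (x : atom M) : option M :=
  match x with inl k => nth_error rho k | inr v => Some v end.

Lemma teval_term_of rho (x : atom M) : teval M rho (term_of L x) = aval rho x.
Proof. destruct x; reflexivity. Qed.

Lemma teval_App rho f (ts : list (term L M)) :
  teval M rho (App f ts) =
  match tevals M rho ts with
  | Some vs => if length vs =? fun_ar L f then Some (@ifun L M f vs) else None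
  | None => None
  end.
Proof.
  simpl. match goal with |- match ?g ts with _ => _ end = _ =>
    assert (E : g ts = tevals M rho ts) end.
  { induction ts as [|t ts IH]; simpl; [reflexivity|]. now rewrite IH. }
  now rewrite E.
Qed.

Lemma tevals_map rho rho' g (ts : list (term L M)) :
  Forall (fun t => teval M rho' (g t) = teval M rho t) ts ->
  tevals M rho' (map g ts) = tevals M rho ts.
Proof. induction 1 as [|t ts H _ IH]; simpl; [reflexivity|]. now rewrite H, IH. Qed.

Lemma teval_tmap s n B rho rho' (t : term L M) :
  (forall x, atom_in n B x -> aval rho' (s x) = aval rho x) ->
  tbound n t -> tparams B t -> teval M rho' (tmap s t) = teval M rho t.
Proof.
  intros Hs. induction t as [k|v|f ts IH] using nested_term_ind.
  - intros H _. simpl. rewrite teval_term_of. apply (Hs (inl k)). exact H.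
  - intros _ H. simpl. rewrite teval_term_of. apply (Hs (inr v)). exact H.
  - rewrite tbound_App, tparams_App. intros H1 H2.
    change (tmap s (App f ts)) with (App f (map (tmap s) ts)).
    rewrite !teval_App, (@tevals_map rho); [reflexivity|].
    rewrite !Forall_forall in *. auto.
Qed.

Lemma aval_shift v rho x : aval (v :: rho) (shift x) = aval rho x.
Proof. destruct x; reflexivity. Qed.

(** Only atoms allowed by [n] and [B] are constrained, so [s] may take junk values elsewhere.
    Generality in [s] lets the induction pass a binder with [lift s]. *)
Lemma sat_fmap (p : formula L M) : forall s n B rho rho',
  (forall x, atom_in n B x -> aval rho' (s x) = aval rho x) ->
  fbound n p -> fparams B p -> (sat M rho' (fmap s p) <-> sat M rho p).
Proof.
  assert (Hl : forall s n B rho rho' v,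
    (forall x, atom_in n B x -> aval rho' (s x) = aval rho x) ->
    forall x, atom_in (S n) B x -> aval (v :: rho') (lift s x) = aval (v :: rho) x).
  { intros s n B rho rho' v Hs [[|k]|u] Hx; simpl in *; auto.
    - rewrite aval_shift. apply (Hs (inl k)). simpl. lia.
    - rewrite aval_shift. apply (Hs (inr u)). auto. }
  induction p as [| |t1 t2|r ts|q IH|q IHq r IHr|q IHq r IHr|q IHq r IHr|q IH|q IH];
    intros s n B rho rho' Hs Hb Hp; simpl in *; try tauto.
  - now rewrite (@teval_tmap s n B rho rho' t1 Hs), (@teval_tmap s n B rho rho' t2 Hs) by tauto.
  - rewrite (@tevals_map rho); [reflexivity|].
    rewrite !Forall_forall in *. intros t Ht. eapply teval_tmap; eauto.
  - now rewrite (IH s n B rho rho').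
  - rewrite (IHq s n B rho rho'), (IHr s n B rho rho'); tauto.
  - rewrite (IHq s n B rho rho'), (IHr s n B rho rho'); tauto.
  - rewrite (IHq s n B rho rho'), (IHr s n B rho rho'); tauto.
  - split; intros [v H]; exists v; revert H;
      apply (IH (lift s) (S n) B _ _ (Hl s n B rho rho' v Hs) Hb Hp).
  - split; intros H v; specialize (H v); revert H;
      apply (IH (lift s) (S n) B _ _ (Hl s n B rho rho' v Hs) Hb Hp).
Qed.

(** The map [s] is specified by its values, so that under a binder [lift s] meets the same
    specification at depth [S d]. *)
Lemma fsubst_fmap (p : formula L M) : forall nx a d s,
  (forall k, s (inl k) = if k <? d + nx then inl k
     else match nth_error a (k - (d + nx)) with Some v => inr v | None => inl k end) ->
  (forall v, s (inr v) = inr v) -> fsubst nx a d p = fmap s p.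
Proof.
  assert (Ht : forall nx a d s (t : term L M),
    (forall k, s (inl k) = if k <? d + nx then inl k
     else match nth_error a (k - (d + nx)) with Some v => inr v | None => inl k end) ->
    (forall v, s (inr v) = inr v) -> tsubst nx a d t = tmap s t).
  { intros nx a d s t H1 H2. induction t as [k|v|f ts IH] using nested_term_ind; simpl.
    - rewrite H1. destruct (k <? d + nx); [reflexivity|].
      destruct (nth_error a (k - (d + nx))); reflexivity.
    - now rewrite H2.
    - f_equal. apply map_ext_in. now rewrite Forall_forall in IH. }
  assert (Hl : forall nx (a : list M) d s,
    (forall k, s (inl k) = if k <? d + nx then inl k
     else match nth_error a (k - (d + nx)) with Some v => inr v | None => inl k end) ->
    forall k, lift s (inl k) = if k <? S d + nx then inl k
     else match nth_error a (k - (S d + nx)) with Some v => inr v | None => inl k end).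
  { intros nx a d s H1 [|k]; simpl; [reflexivity|].
    rewrite H1. change (S k <? S (d + nx)) with (k <? d + nx).
    destruct (k <? d + nx); [reflexivity|].
    destruct (nth_error a (k - (d + nx))); reflexivity. }
  induction p as [| |t1 t2|r ts|q IH|q IHq r IHr|q IHq r IHr|q IHq r IHr|q IH|q IH];
    intros nx a d s H1 H2; simpl in *; try (f_equal; eauto; fail).
  - f_equal. apply map_ext. auto.
  - f_equal. apply IH; [apply Hl; auto|]. intros v. simpl. now rewrite H2.
  - f_equal. apply IH; [apply Hl; auto|]. intros v. simpl. now rewrite H2.
Qed.

Definition instance_atom (nx : nat) (a : list M) (x : atom M) : atom M :=
  match x with
  | inl k => if k <? nx then inl k
             else match nth_error a (k - nx) with Some v => inr v | None => inl k end
  | inr v => inr v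
  end.

Lemma instance_fmap nx a (p : formula L M) :
  instance nx p a = fmap (instance_atom nx a) p.
Proof. apply fsubst_fmap; reflexivity. Qed.

Lemma instance_in (B : M -> Prop) nx a (p : formula L M) :
  fbound (nx + length a) p -> fparams B p ->
  fbound nx (instance nx p a) /\ fparams (fun v => B v \/ In v a) (instance nx p a).
Proof.
  rewrite instance_fmap. apply fmap_in. intros [k|v]; simpl; [|auto].
  intros Hk. destruct (Nat.ltb_spec k nx); simpl; [assumption|].
  destruct (nth_error a (k - nx)) eqn:E; simpl.
  - right. eapply nth_error_In; eauto.
  - apply nth_error_None in E. lia.
Qed.

Lemma sat_instance nx a (p : formula L M) c :
  fbound (nx + length a) p -> length c = nx ->
  (sat M c (instance nx p a) <-> sat M (c ++ a) p).
Proof.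
  intros Hb Hc. rewrite instance_fmap.
  apply sat_fmap with (n := nx + length a) (B := fun _ => True); auto.
  - intros [k|v]; simpl; [|reflexivity]. intros Hk.
    destruct (Nat.ltb_spec k nx); simpl.
    + now rewrite nth_error_app1 by lia.
    + rewrite nth_error_app2 by lia. rewrite Hc.
      destruct (nth_error a (k - nx)) eqn:E; simpl; [reflexivity|].
      apply nth_error_None in E. lia.
  - apply fparams_True.
Qed.

(** * Definable predicates *)

(** Definability is handled semantically: the closure lemmas below replace the writing of explicit
    de Bruijn formulas. *)
Definition defn (B : M -> Prop) (k : nat) (P : list M -> Prop) : Prop :=
  exists p, fbound k p /\ fparams B p /\ forall rho, length rho = k -> (sat M rho p <-> P rho).

(** Each output entry is an input entry or an element of [B]; precomposing with such a map is a
    substitution of atoms and so preserves definability. *)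
Definition dfun (B : M -> Prop) (k k' : nat) (f : list M -> list M) : Prop :=
  exists s : nat -> atom M, (forall i, i < k' -> atom_in k B (s i)) /\
    forall rho, length rho = k ->
      length (f rho) = k' /\ forall i, i < k' -> nth_error (f rho) i = aval rho (s i).

Lemma defn_ext B k (P Q : list M -> Prop) :
  (forall rho, length rho = k -> (P rho <-> Q rho)) -> defn B k P -> defn B k Q.
Proof.
  intros H (p & H1 & H2 & H3). exists p. repeat split; auto; intros.
  - now apply H, H3.
  - now apply H3, H.
Qed.

Lemma defn_mono (B B' : M -> Prop) k P : (forall v, B v -> B' v) -> defn B k P -> defn B' k P.
Proof.
  intros H (p & H1 & H2 & H3). exists p. repeat split; auto; try now apply H3.
  eapply fparams_mono; eauto.
Qed.

Lemma defn_True B k : defn B k (fun _ => True).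
Proof. exists FTrue. simpl. tauto. Qed.

Lemma defn_not B k P : defn B k P -> defn B k (fun r => ~ P r).
Proof.
  intros (p & H1 & H2 & H3). exists (FNot p). simpl. repeat split; auto; intros.
  - now rewrite <- H3.
  - now rewrite H3.
Qed.

Lemma defn_and B k P Q : defn B k P -> defn B k Q -> defn B k (fun r => P r /\ Q r).
Proof.
  intros (p & H1 & H2 & H3) (q & H4 & H5 & H6). exists (FAnd p q). simpl.
  split; [auto|]. split; [auto|]. intros rho Hr. now rewrite H3, H6.
Qed.

Lemma defn_or B k P Q : defn B k P -> defn B k Q -> defn B k (fun r => P r \/ Q r).
Proof.
  intros (p & H1 & H2 & H3) (q & H4 & H5 & H6). exists (FOr p q). simpl.
  split; [auto|]. split; [auto|]. intros rho Hr. now rewrite H3, H6.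
Qed.

Lemma defn_ex1 B k P : defn B (S k) P -> defn B k (fun r => exists v, P (v :: r)).
Proof.
  intros (p & H1 & H2 & H3). exists (FEx p). simpl. split; [auto|]. split; [auto|].
  intros rho Hr. split; intros [v Hv]; exists v; apply H3; simpl; auto.
Qed.

Lemma defn_exapp B m : forall k P, defn B (m + k) P ->
  defn B k (fun r => exists z, length z = m /\ P (z ++ r)).
Proof.
  induction m as [|m IH]; intros k P H.
  - eapply defn_ext; [|exact H]. intros rho _. split.
    + intros Hp. exists []. auto.
    + intros [[|v z] [Hz Hp]]; [exact Hp|discriminate].
  - apply defn_ex1, IH in H. eapply defn_ext; [|exact H]. intros rho _. simpl. split.
    + intros (z & Hz & v & Hp). exists (v :: z). simpl. auto.
    + intros ([|v z] & Hz & Hp); [discriminate|]. exists z. split; [now injection Hz|].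
      exists v. exact Hp.
Qed.

Lemma firstn_app_eq (l l' : list M) n : length l = n -> firstn n (l ++ l') = l.
Proof. intros <-. rewrite firstn_app, Nat.sub_diag, firstn_all. apply app_nil_r. Qed.

Lemma skipn_app_eq (l l' : list M) n : length l = n -> skipn n (l ++ l') = l'.
Proof. intros <-. rewrite skipn_app, Nat.sub_diag, skipn_all. reflexivity. Qed.

(** A quantifier binds index 0, so the quantified tuple stands in front of the free one. The uses of
    [firstn] and [skipn] below follow this convention. *)
Lemma defn_ex B m k (P : list M -> list M -> Prop) :
  defn B (m + k) (fun r => P (skipn m r) (firstn m r)) ->
  defn B k (fun r => exists z, length z = m /\ P r z).
Proof.
  intros H. apply defn_exapp in H. eapply defn_ext; [|exact H].
  intros rho _. split; intros (z & Hz & Hp); exists z; split; auto; revert Hp;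
    rewrite firstn_app_eq, skipn_app_eq by auto; auto.
Qed.

Lemma defn_exin B k (T : Type) (l : list T) (P : T -> list M -> Prop) :
  (forall x, In x l -> defn B k (P x)) -> defn B k (fun r => exists x, In x l /\ P x r).
Proof.
  induction l as [|x l IH]; intros H.
  - exists FFalse. simpl. repeat split; auto; [tauto|]. now intros [? [? _]].
  - eapply defn_ext; [|apply defn_or; [apply (H x); now left|apply IH; intros; apply H; now right]].
    intros rho _. simpl. split.
    + intros [Hx|[y [Hy Hp]]]; eauto.
    + intros [y [[<-|Hy] Hp]]; eauto.
Qed.

Lemma defn_sat B k p : fbound k p -> fparams B p -> defn B k (fun r => sat M r p).
Proof. exists p. tauto. Qed.

Lemma defn_comp B k k' P f : defn B k' P -> dfun B k k' f -> defn B k (fun r => P (f r)).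
Proof.
  intros (p & H1 & H2 & H3) (s & Hs1 & Hs2).
  set (s' := fun x : atom M => match x with inl i => s i | inr v => inr v end).
  exists (fmap s' p).
  destruct (@fmap_in L M p s' k' B k B) as [Hb Hp]; auto.
  { intros [i|v]; simpl; auto. }
  split; [exact Hb|]. split; [exact Hp|]. intros rho Hr. destruct (Hs2 rho Hr) as [Hl Hn].
  rewrite <- H3 by exact Hl. apply sat_fmap with (n := k') (B := B); auto.
  intros [i|v]; simpl; auto. intros Hi. symmetry. auto.
Qed.

Lemma dfun_id B k : dfun B k k (fun r => r).
Proof. exists (fun i => inl i). simpl. auto. Qed.

Lemma dfun_const B k a : (forall v, In v a -> B v) -> dfun B k (length a) (fun _ => a).
Proof.
  intros Ha. exists (fun i => match nth_error a i with Some v => inr v | None => inl i end).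
  split.
  - intros i Hi. destruct (nth_error a i) eqn:E; simpl.
    + apply Ha. eapply nth_error_In; eauto.
    + apply nth_error_None in E. lia.
  - intros rho _. split; [reflexivity|]. intros i Hi. destruct (nth_error a i) eqn:E; simpl; auto.
    apply nth_error_None in E. lia.
Qed.

Lemma dfun_app B k k1 k2 k' f g : dfun B k k1 f -> dfun B k k2 g -> k' = k1 + k2 ->
  dfun B k k' (fun r => f r ++ g r).
Proof.
  intros (s & Hs1 & Hs2) (t & Ht1 & Ht2) ->.
  exists (fun i => if i <? k1 then s i else t (i - k1)). split.
  - intros i Hi. destruct (Nat.ltb_spec i k1); auto. apply Ht1. lia.
  - intros rho Hr. destruct (Hs2 rho Hr) as [Hl Hn], (Ht2 rho Hr) as [Hl' Hn'].
    split; [rewrite length_app; lia|]. intros i Hi. destruct (Nat.ltb_spec i k1).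
    + rewrite nth_error_app1 by lia. auto.
    + rewrite nth_error_app2 by lia. rewrite Hl. apply Hn'. lia.
Qed.

Lemma dfun_firstn B k k1 m f : dfun B k k1 f -> m <= k1 -> dfun B k m (fun r => firstn m (f r)).
Proof.
  intros (s & Hs1 & Hs2) Hm. exists s. split; [intros; apply Hs1; lia|].
  intros rho Hr. destruct (Hs2 rho Hr) as [Hl Hn]. split; [rewrite length_firstn; lia|].
  intros i Hi. rewrite nth_error_firstn. destruct (Nat.ltb_spec i m); [|lia]. apply Hn. lia.
Qed.

Lemma dfun_skipn B k k1 k' m f : dfun B k k1 f -> m <= k1 -> k' = k1 - m ->
  dfun B k k' (fun r => skipn m (f r)).
Proof.
  intros (s & Hs1 & Hs2) Hm ->. exists (fun i => s (m + i)). split; [intros; apply Hs1; lia|].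
  intros rho Hr. destruct (Hs2 rho Hr) as [Hl Hn]. split; [rewrite length_skipn; lia|].
  intros i Hi. rewrite nth_error_skipn. apply Hn. lia.
Qed.

Lemma dfun_comp B k k1 k' f g : dfun B k1 k' g -> dfun B k k1 f -> dfun B k k' (fun r => g (f r)).
Proof.
  intros (t & Ht1 & Ht2) (s & Hs1 & Hs2).
  exists (fun i => match t i with inl j => s j | inr v => inr v end). split.
  - intros i Hi. specialize (Ht1 i Hi). destruct (t i); simpl in *; auto.
  - intros rho Hr. destruct (Hs2 rho Hr) as [Hl Hn], (Ht2 (f rho) Hl) as [Hl' Hn'].
    split; [exact Hl'|]. intros i Hi. rewrite Hn' by exact Hi. specialize (Ht1 i Hi).
    destruct (t i); simpl in *; auto.
Qed.

(** * Binary trees of instances *)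

(* The tuple [pre] fixes the first coordinates: with [pre] non-empty these are the trees in the
   fibre over [pre]. *)
Fixpoint tree (pre : list M) (Delta : fset_Delta M) (n s : nat) (S : list M -> Prop) : Prop :=
  match s with
  | 0 => exists c, length c = n /\ S c
  | S s' => exists mq, In mq Delta /\ exists z, length z = fst mq /\
      tree pre Delta n s' (fun c => S c /\ sat M (pre ++ c ++ z) (snd mq)) /\
      tree pre Delta n s' (fun c => S c /\ ~ sat M (pre ++ c ++ z) (snd mq))
  end.

(** Nodes are translated one by one, so prefix, formulas and parameter tuples may all change as long
    as the sets cut out on tuples of length [n] agree. *)
Lemma tree_mono pre pre' Delta Delta' n s : forall S S' : list M -> Prop,
  (forall m q z, In (m, q) Delta -> length z = m ->
     exists m' q' z', In (m', q') Delta' /\ length z' = m' /\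
       forall c, length c = n -> (sat M (pre ++ c ++ z) q <-> sat M (pre' ++ c ++ z') q')) ->
  (forall c, length c = n -> S c -> S' c) ->
  tree pre Delta n s S -> tree pre' Delta' n s S'.
Proof.
  induction s as [|s IH]; intros S S' HD HS; simpl.
  - intros (c & Hc & H). eauto.
  - intros ([m q] & Hin & z & Hz & H1 & H2).
    destruct (HD m q z Hin Hz) as (m' & q' & z' & Hin' & Hz' & He).
    exists (m', q'). split; [exact Hin'|]. exists z'. split; [exact Hz'|].
    split; [revert H1|revert H2]; apply IH; auto; simpl; intros c Hc [? ?];
      specialize (He c Hc); split; auto; tauto.
Qed.

Lemma tree_sub pre Delta n s (S S' : list M -> Prop) :
  (forall c, length c = n -> S c -> S' c) -> tree pre Delta n s S -> tree pre Delta n s S'.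
Proof. apply tree_mono. intros m q z H1 H2. exists m, q, z. tauto. Qed.

Lemma tree_nonempty pre Delta n s : forall S : list M -> Prop,
  tree pre Delta n s S -> exists c, length c = n /\ S c.
Proof.
  induction s as [|s IH]; intros S H; [exact H|].
  destruct H as (mq & _ & z & _ & H & _). destruct (IH _ H) as (c & Hc & Hs & _). eauto.
Qed.

Lemma tree_anti pre Delta n s : forall t (S : list M -> Prop),
  t <= s -> tree pre Delta n s S -> tree pre Delta n t S.
Proof.
  induction s as [|s IH]; intros [|t] S Hts H; try lia.
  - exact H.
  - eapply tree_nonempty; eauto.
  - destruct H as (mq & Hin & z & Hz & H1 & H2).
    exists mq. split; [auto|]. exists z. split; [auto|].
    split; apply IH; auto; lia.
Qed.

(** Induct on [s]. On each side of the root, either [S2] has a tree of height [t], which ends the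
    proof, or [S1] has a tree one level shorter; if the latter happens on both sides, the root joins
    the two. For [s = 0], an empty [S1] leaves everything to [S2]. *)
Lemma tree_union pre Delta n s : forall t (S S1 S2 : list M -> Prop),
  (forall c, length c = n -> S c -> S1 c \/ S2 c) ->
  tree pre Delta n (s + t) S -> tree pre Delta n s S1 \/ tree pre Delta n t S2.
Proof.
  induction s as [|s IH]; intros t S S1 S2 HS H.
  - destruct (classic (exists c, length c = n /\ S1 c)) as [H1|H1]; [now left|right].
    revert H. apply tree_sub. intros c Hc Hs.
    destruct (HS c Hc Hs); auto. exfalso. eauto.
  - destruct H as (mq & Hin & z & Hz & H1 & H2).
    (* Only [S1] is cut by the side of [z]: a tree found in [S2] on one side is already final. *)
    eapply IH with (S1 := fun c => S1 c /\ sat M (pre ++ c ++ z) (snd mq)) (S2 := S2) in H1;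
      [|intros c Hc [Hs ?]; destruct (HS c Hc Hs); auto].
    eapply IH with (S1 := fun c => S1 c /\ ~ sat M (pre ++ c ++ z) (snd mq)) (S2 := S2) in H2;
      [|intros c Hc [Hs ?]; destruct (HS c Hc Hs); auto].
    destruct H1 as [H1|H1]; [|auto]. destruct H2 as [H2|H2]; [|auto].
    left. exists mq. split; [auto|]. exists z. auto.
Qed.

Ltac dfun_tac :=
  repeat first
    [ lia
    | reflexivity
    | apply dfun_id
    | eassumption
    | eapply dfun_app
    | eapply dfun_firstn
    | eapply dfun_skipn
    | apply dfun_const; solve [auto] ].

(** Unfolding the recursion gives disjunctions over the finite [Delta] and existential quantifiers
    over instances. The set [P r] and the prefix [g r] vary with the assignment, so the induction
    can absorb the conditions imposed by the root. *)
Lemma defn_tree B n np Delta s :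
  (forall m q, In (m, q) Delta -> fbound (np + (n + m)) q /\ fparams B q) ->
  forall k g (P : list M -> list M -> Prop), dfun B k np g ->
  defn B (n + k) (fun r => P (skipn n r) (firstn n r)) ->
  defn B k (fun r => tree (g r) Delta n s (P r)).
Proof.
  intros HD. induction s as [|s IH]; intros k g P Hg HP; simpl.
  - apply defn_ex. exact HP.
  - apply defn_exin. intros [m q] Hin. destruct (HD m q Hin) as [Hb Hp]. simpl.
    apply defn_ex with (P := fun r z =>
      tree (g r) Delta n s (fun c => P r c /\ sat M (g r ++ c ++ z) q) /\
      tree (g r) Delta n s (fun c => P r c /\ ~ sat M (g r ++ c ++ z) q)).
    (* Below the root the assignment is [z ++ r], and [c ++ z ++ r] when a point is tested; the
       hypotheses on [g] and [P] are moved along these shifts. *)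
    assert (Hg1 : dfun B (m + k) np (fun r => g (skipn m r))).
    { apply dfun_comp with (k1 := k); auto. dfun_tac. }
    assert (HP1 : defn B (n + (m + k)) (fun r => P (skipn m (skipn n r)) (firstn n r))).
    { eapply defn_ext; [|apply (@defn_comp B (n + (m + k)) (n + k)
        (fun r => P (skipn n r) (firstn n r))
        (fun r => firstn n r ++ skipn m (skipn n r)) HP); dfun_tac].
      intros rho Hr. cbv beta. rewrite firstn_app_eq, skipn_app_eq by (rewrite length_firstn; lia).
      reflexivity. }
    assert (Hq : defn B (n + (m + k)) (fun r =>
      sat M (g (skipn m (skipn n r)) ++ firstn n r ++ firstn m (skipn n r)) q)).
    { apply defn_comp with (P := fun r => sat M r q) (k' := np + (n + m))
        (f := fun r => g (skipn m (skipn n r)) ++ firstn n r ++ firstn m (skipn n r)).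
      - apply defn_sat; auto.
      - apply dfun_app with (k1 := np) (k2 := n + m); auto.
        + apply dfun_comp with (k1 := k); auto. dfun_tac.
        + dfun_tac. }
    apply defn_and; apply IH with (P := fun r c => _ /\ _); auto.
    + apply defn_and; auto.
    + apply defn_and; auto. apply defn_not; auto.
Qed.
(** * Trees and op-rank *)

(** Finite choice: one new formula picked for each formula of a finite set yields a finite set
    again. *)
Lemma exists_image (T U : Type) (R : T -> U -> Prop) (l : list T) :
  (forall x, In x l -> exists y, R x y) ->
  exists l', (forall y, In y l' -> exists x, In x l /\ R x y) /\
    (forall x, In x l -> exists y, In y l' /\ R x y).
Proof.
  induction l as [|x l IH]; intros H.
  - exists []. split; intros ? [].
  - destruct IH as (l' & H1 & H2); [intros; apply H; now right|].
    destruct (H x (or_introl eq_refl)) as [y Hy]. exists (y :: l'). split.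
    + intros y' [<-|Hy']; [exists x; simpl; auto|].
      destruct (H1 y' Hy') as (x' & ? & ?). exists x'. simpl. auto.
    + intros x' [<-|Hx']; [exists y; simpl; auto|].
      destruct (H2 x' Hx') as (y' & ? & ?). exists y'. simpl. auto.
Qed.

(* Hilbert's hotel: an injection of [K] hitting [v] is shifted along a copy of [nat]. *)
Lemma small_add (K : Type) (B : M -> Prop) v :
  (exists e : nat -> K, forall n m, e n = e m -> n = m) ->
  small M K B -> small M K (fun u => B u \/ u = v).
Proof.
  intros [e He] HB [g [Hg HgB]]. apply HB.
  destruct (classic (exists k, g k = v)) as [[k0 Hk0]|Hno].
  2:{ exists g. split; [exact Hg|]. intros k. destruct (HgB k); auto. exfalso. eauto. }
  enough (exists h : K -> K, (forall k1 k2, h k1 = h k2 -> k1 = k2) /\ forall k, h k <> k0)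
    as (h & Hh & Hh0).
  { exists (fun k => g (h k)). split; [auto|]. intros k.
    destruct (HgB (h k)) as [|E]; auto. rewrite <- Hk0 in E. apply Hg in E. now apply Hh0 in E. }
  assert (Hs : exists s : K -> K, (forall k1 k2, s k1 = s k2 -> k1 = k2) /\ forall k, s k <> e 0).
  { destruct (choice (fun k k' => (exists n, k = e n /\ k' = e (S n)) \/
      ((forall n, k <> e n) /\ k' = k))) as [s Hs].
    { intros k. destruct (classic (exists n, k = e n)) as [[n Hn]|Hn].
      - exists (e (S n)). eauto.
      - exists k. right. split; [|reflexivity]. intros n E. eauto. }
    exists s. split.
    - intros k1 k2 E. destruct (Hs k1) as [(n1 & E1 & F1)|[N1 F1]],
        (Hs k2) as [(n2 & E2 & F2)|[N2 F2]]; rewrite F1, F2 in E; subst.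
      + apply He in E. congruence.
      + exfalso. eapply N2. eauto.
      + exfalso. eapply N1. eauto.
      + congruence.
    - intros k E. destruct (Hs k) as [(n & _ & F)|[N F]]; rewrite F in E.
      + apply He in E. discriminate.
      + eapply N; eauto. }
  destruct Hs as (s & Hs1 & Hs2).
  destruct (choice (fun k k' => (s k = k0 /\ k' = e 0) \/ (s k <> k0 /\ k' = s k))) as [h Hh].
  { intros k. destruct (classic (s k = k0)); eauto. }
  exists h. split.
  - intros k1 k2 E. destruct (Hh k1) as [[E1 F1]|[E1 F1]], (Hh k2) as [[E2 F2]|[E2 F2]];
      rewrite F1, F2 in E.
    + apply Hs1. congruence.
    + exfalso. eapply Hs2; eauto.
    + exfalso. eapply Hs2; eauto.
    + auto.
  - intros k E. destruct (Hh k) as [[E1 F1]|[E1 F1]]; rewrite F1 in E; [|auto].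
    apply (Hs2 k). congruence.
Qed.

Lemma small_mono (K : Type) (B B' : M -> Prop) :
  (forall v, B' v -> B v) -> small M K B -> small M K B'.
Proof. intros H HB (g & H1 & H2). apply HB. exists g. auto. Qed.

Lemma small_list (K : Type) (B : M -> Prop) l :
  (exists e : nat -> K, forall n m, e n = e m -> n = m) ->
  small M K B -> small M K (fun u => B u \/ In u l).
Proof.
  intros He HB. induction l as [|v l IH].
  - revert HB. apply small_mono. intros v [|[]]; auto.
  - apply (@small_add K _ v He) in IH. revert IH. apply small_mono.
    intros u [|[<-|]]; auto.
Qed.

(** The finitary form of an infinite binary tree in [pi]: every finite height, inside each finite
    part of [pi]. The set [D] records the sides chosen so far. *)
Definition ample (Delta : fset_Delta M) (nx : nat) (pi : ptype M) (D : list M -> Prop) : Prop :=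
  forall l s, (forall p, In p l -> pi p) ->
    tree [] Delta nx s (fun c => (forall p, In p l -> sat M c p) /\ D c).

Lemma ample_sub Delta nx pi (D D' : list M -> Prop) :
  (forall c, length c = nx -> D c -> D' c) -> ample Delta nx pi D -> ample Delta nx pi D'.
Proof.
  intros HD H l s Hl. generalize (H l s Hl). apply tree_sub.
  intros c Hc [? ?]. auto.
Qed.

Lemma defn_all B nx (l : list (formula L M)) :
  (forall p, In p l -> fbound nx p /\ fparams B p) ->
  defn B nx (fun c => forall p, In p l -> sat M c p).
Proof.
  induction l as [|p l IH]; intros H.
  - eapply defn_ext; [|apply defn_True]. simpl. firstorder.
  - eapply defn_ext; [|apply defn_and; [apply (@defn_sat B nx p)|apply IH]].
    + intros rho _. simpl. split; [intros [? ?] ? [<-|?]|]; auto.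
    + apply H. now left.
    + apply H. now left.
    + intros q Hq. apply H. now right.
Qed.

Definition over (B : M -> Prop) (nx : nat) (pi : ptype M) : Prop :=
  forall p, pi p -> fbound nx p /\ fparams B p.

Definition Delta_over (B : M -> Prop) (nx : nat) (Delta : fset_Delta M) : Prop :=
  forall m q, In (m, q) Delta -> fbound (nx + m) q /\ fparams B q.

(* Compactness: the trees of height [s + 1] provide, for each [s], an instance both sides of
   which carry trees of height [s]; one of the finitely many formulas serves all [s], and by
   saturation so does one instance. *)
Lemma ample_split (K : Type) B nx Delta pi D :
  kappa_saturated M K -> small M K B -> over B nx pi -> Delta_over B nx Delta ->
  defn B nx D -> ample Delta nx pi D ->
  exists m q z, In (m, q) Delta /\ length z = m /\
    ample Delta nx pi (fun c => D c /\ sat M (c ++ z) q) /\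
    ample Delta nx pi (fun c => D c /\ ~ sat M (c ++ z) q).
Proof.
  intros Hsat HB Hpi HDel HD HA.
  (* Both sides of [z] carry trees of height [s]. The condition gets stronger as [l] and [s] grow,
     so finitely many such conditions follow from one. *)
  set (tau := fun l s q z =>
    tree [] Delta nx s (fun c => ((forall p, In p l -> sat M c p) /\ D c) /\ sat M (c ++ z) q) /\
    tree [] Delta nx s (fun c => ((forall p, In p l -> sat M c p) /\ D c) /\ ~ sat M (c ++ z) q)).
  assert (Hmono : forall l l' s s' q z, incl l l' -> s <= s' -> tau l' s' q z -> tau l s q z).
  { intros l l' s s' q z Hl Hs [H1 H2]. split; (eapply tree_anti; [exact Hs|]);
      [revert H1|revert H2]; apply tree_sub; intros c _ [[? ?] ?]; auto. }
  (* If every formula of [Delta] failed at some [l] and [s], the union of the lists and the maximum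
     of the heights would defeat the root of a tree one level higher. *)
  assert (Hq : exists mq, In mq Delta /\ forall l s, (forall p, In p l -> pi p) ->
    exists z, length z = fst mq /\ tau l s (snd mq) z).
  { apply NNPP. intros Hno.
    assert (Hc : forall Del, incl Del Delta -> exists l s, (forall p, In p l -> pi p) /\
      forall mq, In mq Del -> forall z, length z = fst mq -> ~ tau l s (snd mq) z).
    { induction Del as [|mq Del IH]; intros Hincl.
      - exists [], 0. split; intros ? [].
      - destruct IH as (l1 & s1 & Hl1 & H1); [intros x Hx; apply Hincl; now right|].
        assert (Hmq : exists l s, (forall p, In p l -> pi p) /\
          forall z, length z = fst mq -> ~ tau l s (snd mq) z).
        { apply NNPP. intros Hn. apply Hno. exists mq. split; [apply Hincl; now left|].
          intros l s Hl. apply NNPP. intros Hz. apply Hn. exists l, s. split; [auto|].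
          intros z Hlz Ht. eauto. }
        destruct Hmq as (l2 & s2 & Hl2 & H2).
        exists (l1 ++ l2), (max s1 s2). split.
        + intros p Hp. apply in_app_or in Hp as [|]; auto.
        + intros mq' [<-|Hin] z Hz Ht.
          * apply (H2 z Hz). revert Ht. apply Hmono; [apply incl_appr, incl_refl|lia].
          * apply (H1 mq' Hin z Hz). revert Ht. apply Hmono; [apply incl_appl, incl_refl|lia]. }
    destruct (Hc Delta (incl_refl _)) as (l & s & Hl & H).
    destruct (HA l (S s) Hl) as (mq & Hin & z & Hz & Ht). exact (H mq Hin z Hz Ht). }
  destruct Hq as ([m q] & Hin & Hq). simpl in Hq.
  (* Saturation takes formulas, while [tau] is a predicate; so [Gamma] collects all formulas over
     [B] implied by some [tau l s q]. Since each [tau l s q] is definable over [B], a realization of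
     [Gamma] satisfies all of them. *)
  set (Gamma := fun f : formula L M => (fbound m f /\ fparams B f) /\
    exists l s, (forall p, In p l -> pi p) /\ forall z, length z = m -> tau l s q z -> sat M z f).
  assert (Hdef : forall l s, (forall p, In p l -> pi p) -> defn B m (tau l s q)).
  { intros l s Hl.
    assert (Hb : defn B (nx + m) (fun r => (forall p, In p l -> sat M (firstn nx r) p) /\
      D (firstn nx r))).
    { apply defn_comp with (P := fun c => (forall p, In p l -> sat M c p) /\ D c)
        (k' := nx) (f := fun r => firstn nx r); [|dfun_tac].
      apply defn_and; [apply defn_all; auto|exact HD]. }
    assert (Hs : defn B (nx + m) (fun r => sat M (firstn nx r ++ skipn nx r) q)).
    { apply defn_comp with (P := fun r => sat M r q) (k' := nx + m)
        (f := fun r => firstn nx r ++ skipn nx r); [|dfun_tac].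
      apply defn_sat; apply (HDel m q Hin). }
    apply defn_and; apply (@defn_tree B nx 0 Delta s HDel m (fun _ => []));
      try (apply (@dfun_const B m []); intros ? []); apply defn_and; auto.
    apply defn_not; auto. }
  destruct (Hsat B m Gamma HB) as (z & Hz & HG).
  - intros f [H _]. exact H.
  - intros fs Hfs.
    assert (Hc : exists l s, (forall p, In p l -> pi p) /\
      forall z, length z = m -> tau l s q z -> forall f, In f fs -> sat M z f).
    { induction fs as [|f fs IH].
      - exists [], 0. split; [intros ? []|]. intros z _ _ f [].
      - destruct IH as (l1 & s1 & Hl1 & H1); [intros; apply Hfs; now right|].
        destruct (Hfs f (or_introl eq_refl)) as (_ & l2 & s2 & Hl2 & H2).
        exists (l1 ++ l2), (max s1 s2). split.
        + intros p Hp. apply in_app_or in Hp as [|]; auto.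
        + intros z Hz Ht f' [<-|Hin'].
          * apply H2; auto. revert Ht. apply Hmono; [apply incl_appr, incl_refl|lia].
          * apply H1; auto. revert Ht. apply Hmono; [apply incl_appl, incl_refl|lia]. }
    destruct Hc as (l & s & Hl & H). destruct (Hq l s Hl) as (z & Hz & Ht).
    exists z. split; [exact Hz|]. intros f Hf. exact (H z Hz Ht f Hf).
  - assert (Ht : forall l s, (forall p, In p l -> pi p) -> tau l s q z).
    { intros l s Hl. destruct (Hdef l s Hl) as (f & Hb & Hp & Hf).
      apply Hf; [exact Hz|]. apply HG. split; [auto|]. exists l, s. split; [exact Hl|].
      intros z' Hz' Ht. now apply Hf. }
    exists m, q, z. split; [exact Hin|]. split; [exact Hz|].
    split; intros l s Hl; destruct (Ht l s Hl) as [H1 H2]; [revert H1|revert H2];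
      apply tree_sub; tauto.
Qed.

Lemma over_mono (B B' : M -> Prop) nx pi : (forall v, B v -> B' v) -> over B nx pi -> over B' nx pi.
Proof. intros H Hpi p Hp. destruct (Hpi p Hp). split; auto. eapply fparams_mono; eauto. Qed.

Lemma Delta_over_mono (B B' : M -> Prop) nx Delta :
  (forall v, B v -> B' v) -> Delta_over B nx Delta -> Delta_over B' nx Delta.
Proof. intros H HD m q Hq. destruct (HD m q Hq). split; auto. eapply fparams_mono; eauto. Qed.

Lemma Delta_over_finite nx (Delta : fset_Delta M) :
  wf_Delta nx Delta -> exists l, Delta_over (fun v => In v l) nx Delta.
Proof.
  intros Hwf. enough (exists l, forall m q, In (m, q) Delta -> fparams (fun v => In v l) q)
    as [l Hl] by (exists l; intros m q Hq; split; [exact (Hwf m q Hq)|eauto]).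
  clear Hwf. induction Delta as [|[m q] Delta [l1 H1]].
  - exists []. intros ? ? [].
  - destruct (fparams_finite q) as [l2 H2]. exists (l1 ++ l2).
    intros m' q' [E|Hin].
    + injection E as <- <-. revert H2. apply fparams_mono. intros; apply in_or_app; auto.
    + generalize (H1 _ _ Hin). apply fparams_mono. intros; apply in_or_app; auto.
Qed.

(** The gluing of two instances along a first one: if the first holds then the second, else the
    third, with the parameter tuples concatenated. *)
Lemma exists_mixed_formula nx (d1 d2 d3 : nat * formula L M) :
  fbound (nx + fst d1) (snd d1) -> fbound (nx + fst d2) (snd d2) ->
  fbound (nx + fst d3) (snd d3) ->
  exists d, fst d = fst d1 + (fst d2 + fst d3) /\ fbound (nx + fst d) (snd d) /\
    forall c z1 z2 z3, length c = nx -> length z1 = fst d1 -> length z2 = fst d2 ->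
      length z3 = fst d3 ->
      (sat M (c ++ z1 ++ z2 ++ z3) (snd d) <->
       (sat M (c ++ z1) (snd d1) /\ sat M (c ++ z2) (snd d2)) \/
       (~ sat M (c ++ z1) (snd d1) /\ sat M (c ++ z3) (snd d3))).
Proof.
  destruct d1 as [m1 q1], d2 as [m2 q2], d3 as [m3 q3]. simpl. intros H1 H2 H3.
  assert (Hd : forall m q f, fbound (nx + m) q ->
    dfun (fun _ => True) (nx + (m1 + (m2 + m3))) m f ->
    defn (fun _ => True) (nx + (m1 + (m2 + m3))) (fun r => sat M (firstn nx r ++ f r) q)).
  { intros m q f Hb Hf. apply defn_comp with (P := fun r => sat M r q) (k' := nx + m)
      (f := fun r => firstn nx r ++ f r); [|dfun_tac].
    apply defn_sat; [exact Hb|apply fparams_True]. }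
  assert (D1 := Hd m1 q1 (fun r => firstn m1 (skipn nx r)) H1 ltac:(dfun_tac)).
  assert (D2 := Hd m2 q2 (fun r => firstn m2 (skipn m1 (skipn nx r))) H2 ltac:(dfun_tac)).
  assert (D3 := Hd m3 q3 (fun r => skipn m2 (skipn m1 (skipn nx r))) H3 ltac:(dfun_tac)).
  destruct (defn_or (defn_and D1 D2) (defn_and (defn_not D1) D3)) as (f & Hb & _ & Hf).
  exists (m1 + (m2 + m3), f). simpl. split; [reflexivity|]. split; [exact Hb|].
  intros c z1 z2 z3 Hc Hz1 Hz2 Hz3. rewrite Hf by (rewrite !length_app; lia).
  rewrite (skipn_app_eq c), (firstn_app_eq c), (skipn_app_eq z1), (firstn_app_eq z1),
    (skipn_app_eq z2), (firstn_app_eq z2) by assumption.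
  reflexivity.
Qed.

(* The [n + 1] formulas are a formula splitting the type and, on its two sides, the [n] formulas
   provided by the induction, glued along the first one: so an infinite binary tree
   already yields infinite rank for every [n]. *)
Lemma ample_splits (K : Type) nx Delta :
  (exists e : nat -> K, forall n m, e n = e m -> n = m) ->
  kappa_saturated M K -> wf_Delta nx Delta ->
  forall n, exists Delta', wf_Delta nx Delta' /\
    forall B pi D, small M K B -> over B nx pi -> Delta_over B nx Delta -> defn B nx D ->
    ample Delta nx pi D ->
    exists (phis : nat -> nat * formula L M) (a : nat -> list M),
      (forall i, i < n -> In (phis i) Delta' /\ length (a i) = fst (phis i)) /\
      forall sigma : nat -> bool, ample Delta nx pi
        (fun c => D c /\ forall i, i < n -> (sat M (c ++ a i) (snd (phis i)) <-> sigma i = true)).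
Proof.
  intros He Hsat Hwf. induction n as [|n (Delta1 & Hwf1 & IH)].
  - exists []. split; [intros ? ? []|]. intros B pi D _ _ _ _ HA.
    exists (fun _ => (0, FTrue)), (fun _ => []). split; [lia|]. intros sigma.
    revert HA. apply ample_sub. intros c _ Hc. split; [exact Hc|lia].
  (* All triples are glued in advance: [Delta2] has to be chosen before the type, because the rank
     uses one finite set at every node. *)
  - destruct (@exists_image _ _
      (fun (t : (nat * formula L M) * ((nat * formula L M) * (nat * formula L M))) d =>
      fst d = fst (fst t) + (fst (fst (snd t)) + fst (snd (snd t))) /\ fbound (nx + fst d) (snd d) /\
      forall c z1 z2 z3, length c = nx -> length z1 = fst (fst t) ->
        length z2 = fst (fst (snd t)) -> length z3 = fst (snd (snd t)) ->
        (sat M (c ++ z1 ++ z2 ++ z3) (snd d) <->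
         (sat M (c ++ z1) (snd (fst t)) /\ sat M (c ++ z2) (snd (fst (snd t)))) \/
         (~ sat M (c ++ z1) (snd (fst t)) /\ sat M (c ++ z3) (snd (snd (snd t))))))
      (list_prod Delta (list_prod Delta1 Delta1))) as (Delta2 & H1 & H2).
    { intros [[m1 q1] [[m2 q2] [m3 q3]]] Hin.
      apply in_prod_iff in Hin as [Hi1 Hin]. apply in_prod_iff in Hin as [Hi2 Hi3].
      apply exists_mixed_formula; simpl; auto. }
    exists (Delta ++ Delta2). split.
    { intros m q Hq. apply in_app_or in Hq as [Hq|Hq]; [auto|].
      destruct (H1 _ Hq) as (_ & _ & _ & Hb & _). exact Hb. }
    intros B pi D HB Hpi HDel HD HA.
    destruct (ample_split Hsat HB Hpi HDel HD HA) as (m & q & z & Hin & Hz & HA1 & HA0).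
    set (B' := fun v => B v \/ In v z).
    assert (HBB' : forall v, B v -> B' v) by (unfold B'; auto).
    assert (HB' : small M K B') by (apply small_list; auto).
    assert (Hpi' := @over_mono B B' nx pi HBB' Hpi). assert (HDel' := @Delta_over_mono B B' nx Delta HBB' HDel).
    assert (HD' := @defn_mono B B' nx D HBB' HD).
    assert (Hq : defn B' nx (fun c => sat M (c ++ z) q)).
    { apply defn_comp with (P := fun r => sat M r q) (k' := nx + m) (f := fun r => r ++ z).
      - apply defn_sat; apply (HDel' m q Hin).
      - eapply dfun_app; [apply dfun_id|apply dfun_const; unfold B'; auto|lia]. }
    destruct (IH B' pi _ HB' Hpi' HDel' (defn_and HD' Hq) HA1) as (phi1 & a1 & Ha1 & Hs1).
    destruct (IH B' pi _ HB' Hpi' HDel' (defn_and HD' (defn_not Hq)) HA0)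
      as (phi0 & a0 & Ha0 & Hs0).
    destruct (choice (fun i d => i < n -> In d Delta2 /\
      length (z ++ a1 i ++ a0 i) = fst d /\ forall c, length c = nx ->
       (sat M (c ++ z ++ a1 i ++ a0 i) (snd d) <->
        (sat M (c ++ z) q /\ sat M (c ++ a1 i) (snd (phi1 i))) \/
        (~ sat M (c ++ z) q /\ sat M (c ++ a0 i) (snd (phi0 i)))))) as [psi Hpsi].
    (* The pair [(0, FTrue)] is a default for indices beyond the [n] instances. *)
    { intros i. destruct (lt_dec i n) as [Hi|Hi]; [|exists (0, FTrue); lia].
      destruct (Ha1 i Hi) as [Hi1 Hl1], (Ha0 i Hi) as [Hi0 Hl0].
      destruct (H2 ((m, q), (phi1 i, phi0 i))) as (d & Hd & Hfd & Hbd & Hsd).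
      { apply in_prod; [auto|]. apply in_prod; auto. }
      exists d. intros _. split; [exact Hd|]. simpl in *. split.
      - rewrite !length_app. lia.
      - intros c Hc. now apply Hsd. }
    exists (fun i => match i with 0 => (m, q) | S i => psi i end),
      (fun i => match i with 0 => z | S i => z ++ a1 i ++ a0 i end).
    split.
    { intros [|i] Hi.
      - split; [apply in_or_app; auto|exact Hz].
      - destruct (Hpsi i) as (? & ? & _); [lia|]. split; [apply in_or_app; auto|auto]. }
    (* On the side of [z] chosen by [sigma 0], each glued instance agrees with the one found on that
       side, so the remaining signs are realized there. *)
    intros sigma. destruct (sigma 0) eqn:E.
    + generalize (Hs1 (fun i => sigma (S i))). apply ample_sub. intros c Hc [[Hd Hcq] Hi].
      split; [exact Hd|]. intros [|i] Hin'; simpl; [rewrite E; tauto|].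
      destruct (Hpsi i) as (_ & _ & Hsat'); [lia|]. rewrite (Hsat' c Hc), <- (Hi i) by lia. tauto.
    + generalize (Hs0 (fun i => sigma (S i))). apply ample_sub. intros c Hc [[Hd Hcq] Hi].
      split; [exact Hd|]. intros [|i] Hin'; simpl; [rewrite E; intuition discriminate|].
      destruct (Hpsi i) as (_ & _ & Hsat'); [lia|]. rewrite (Hsat' c Hc), <- (Hi i) by lia. tauto.
Qed.

Lemma sat_bigand c (l : list (formula L M)) :
  sat M c (bigand l) <-> forall p, In p l -> sat M c p.
Proof.
  induction l as [|p [|q l] IH].
  - simpl. firstorder.
  - simpl. split; [intros H ? [<-|[]]|]; auto.
  - change (sat M c p /\ sat M c (bigand (q :: l)) <-> forall r, In r (p :: q :: l) -> sat M c r).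
    rewrite IH. split.
    + intros [Hp Hl] r [<-|Hr]; auto.
    + intros H. split; intros; apply H; simpl in *; auto.
Qed.

Lemma bigand_in n B (l : list (formula L M)) :
  (forall p, In p l -> fbound n p /\ fparams B p) -> fbound n (bigand l) /\ fparams B (bigand l).
Proof.
  induction l as [|p [|q l] IH]; intros H.
  - simpl. auto.
  - apply H. now left.
  - destruct (H p (or_introl eq_refl)), IH as [? ?]; [intros; apply H; now right|].
    split; split; auto.
Qed.

Lemma sat_fpow c (p : formula L M) b : sat M c (fpow p b) <-> (sat M c p <-> b = true).
Proof. destruct b; simpl; intuition discriminate. Qed.

(** Well-founded induction on the ordinal: [ample_splits] provides the instances, and every sign
    pattern leaves an ample type, to which the induction applies. *)
Lemma ample_opR_inf (K : Type) B nx Delta pi :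
  (exists e : nat -> K, forall n m, e n = e m -> n = m) ->
  kappa_saturated M K -> small M K B -> over B nx pi -> wf_Delta nx Delta ->
  ample Delta nx pi (fun _ => True) ->
  forall n, exists Delta', wf_Delta nx Delta' /\ opR_inf nx n Delta' pi.
Proof.
  intros He Hsat HB Hpi Hwf HA n.
  destruct (ample_splits He Hsat Hwf n) as (Delta' & Hwf' & Hspl).
  exists Delta'. split; [exact Hwf'|]. intros W R HR w.
  destruct (Delta_over_finite Hwf) as [l0 Hl0].
  (* The type and its small parameter set vary together, since each step adds a formula with
     finitely many new parameters. Those of [Delta] are added at the start. *)
  assert (Hgen : forall pi B, small M K B -> over B nx pi -> Delta_over B nx Delta ->
    ample Delta nx pi (fun _ => True) -> rank_ge R nx n Delta' w pi).
  2:{ apply (Hgen pi (fun v => B v \/ In v l0)); auto.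
      - apply small_list; auto.
      - revert Hpi. apply over_mono. auto.
      - revert Hl0. apply Delta_over_mono. auto. }
  clear pi B HB Hpi HA. induction (HR w) as [w _ IHw].
  intros pi B HB Hpi HDel HA. constructor.
  - intros l Hl. destruct (HA l 0 Hl) as (c & Hc & H & _). eauto.
  - intros v Hv.
    destruct (Hspl B pi (fun _ => True) HB Hpi HDel (defn_True _ _) HA) as (phis & a & Ha & Hs).
    exists phis, a. split; [exact Ha|]. intros sigma.
    match goal with |- rank_ge _ _ _ _ _ (add_formula _ ?b) => set (beta := b) end.
    assert (Hbeta : fbound nx beta /\ forall c, length c = nx -> (sat M c beta <->
      forall i, i < n -> (sat M (c ++ a i) (snd (phis i)) <-> sigma i = true))).
    { assert (Hb : forall i, i < n -> fbound (nx + length (a i)) (snd (phis i))).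
      { intros i Hi. destruct (Ha i Hi) as [Hin Hlen]. rewrite Hlen. apply Hwf'.
        now rewrite <- surjective_pairing. }
      split.
      - apply (@bigand_in nx (fun _ => True)). intros p Hp.
        apply in_map_iff in Hp as (i & <- & Hi). apply in_seq in Hi.
        split; [|apply fparams_True].
        destruct (@instance_in (fun v => True) nx (a i) (snd (phis i))) as [Hi1 _].
        + apply Hb. lia.
        + apply fparams_True.
        + destruct (sigma i); exact Hi1.
      - intros c Hc. unfold beta. rewrite sat_bigand. split.
        + intros H i Hi. rewrite <- (@sat_instance nx) by auto. apply sat_fpow, H.
          apply in_map_iff. exists i. split; [reflexivity|]. apply in_seq. lia.
        + intros H p Hp. apply in_map_iff in Hp as (i & <- & Hi). apply in_seq in Hi.
          apply sat_fpow. rewrite sat_instance by (try apply Hb; auto; lia). apply H. lia. }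
    destruct Hbeta as [Hbb Hbs]. destruct (fparams_finite beta) as [lb Hlb].
    apply (IHw v Hv) with (B := fun u => B u \/ In u lb).
    + apply small_list; auto.
    + intros p [Hp| ->].
      * destruct (Hpi p Hp). split; auto. eapply fparams_mono; [|eassumption]. auto.
      * split; [exact Hbb|]. revert Hlb. apply fparams_mono. auto.
    + revert HDel. apply Delta_over_mono. auto.
    + intros l s Hl.
      (* In a finite part of the enlarged type, [beta] is separated from the formulas of [pi]; the
         set carried by [ample] accounts for it. *)
      assert (Hl' : exists l', (forall p, In p l' -> pi p) /\
        forall p, In p l -> In p l' \/ p = beta).
      { induction l as [|p l IHl].
        - exists []. split; intros ? [].
        - destruct IHl as (l' & H1 & H2); [intros; apply Hl; now right|].
          destruct (Hl p (or_introl eq_refl)) as [Hp| ->].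
          + exists (p :: l'). split; [intros ? [<-|]; auto|].
            intros q [E|Hq]; [subst; left; now left|]. destruct (H2 q Hq); [left; now right|auto].
          + exists l'. split; [auto|]. intros q [E|Hq]; [subst|]; auto. }
      destruct Hl' as (l' & H1 & H2). generalize (Hs sigma l' s H1). apply tree_sub.
      intros c Hc [Hc1 [_ Hc2]]. split; [|exact I]. intros p Hp.
      destruct (H2 p Hp) as [| ->]; auto. now apply Hbs.
Qed.

(** Of the [n] instances only the first, which exists as [0 < n], serves as root: the two constant
    sign patterns give its two sides, both of the smaller rank. *)
Lemma rank_ge_tree nx n Delta : 0 < n -> wf_Delta nx Delta ->
  forall s pi, rank_ge lt nx n Delta s pi ->
  forall l : list (formula L M), (forall p, In p l -> pi p) ->
    tree [] Delta nx s (fun c => forall p, In p l -> sat M c p).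
Proof.
  intros Hn Hwf. induction s as [|s IH]; intros pi HR l Hl.
  - inversion HR as [w pi' Hcons _ Ew Epi]. subst. exact (Hcons l Hl).
  - inversion HR as [w pi' Hcons Hstep Ew Epi]. subst.
    destruct (Hstep s (Nat.lt_succ_diag_r s)) as (phis & a & Ha & Hs).
    destruct (Ha 0 Hn) as [Hin Hlen]. exists (phis 0). split; [exact Hin|].
    exists (a 0). split; [exact Hlen|].
    assert (Hside : forall b, tree [] Delta nx s (fun c => (forall p, In p l -> sat M c p) /\
      (sat M (c ++ a 0) (snd (phis 0)) <-> b = true))).
    { intros b. specialize (Hs (fun _ => b)).
      match type of Hs with rank_ge _ _ _ _ _ (add_formula _ ?q) =>
        assert (Ht := IH _ Hs (q :: l)) end.
      generalize (Ht ltac:(intros p [Hp|Hp]; [right; symmetry; exact Hp|left; apply Hl; exact Hp])).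
      apply tree_sub. intros c Hc H. split; [intros; apply H; now right|].
      specialize (H _ (or_introl eq_refl)). rewrite sat_bigand in H.
      rewrite <- (@sat_instance nx); auto.
      - apply sat_fpow, H. apply in_map_iff. exists 0. split; [reflexivity|].
        apply in_seq. lia.
      - rewrite Hlen. apply Hwf. now rewrite <- surjective_pairing. }
    split; [generalize (Hside true)|generalize (Hside false)]; apply tree_sub;
      intros c _ [H1 H2]; split; auto; simpl; intuition discriminate.
Qed.
(** * Trees over a fibration *)

(** Both formulas exist because carrying a tree of height [r] is definable. [psi] will split the
    base, and [theta'] cuts out the points to be discarded; [z] joins the parameters [w], so that
    [theta'] can be fed to an induction over all formulas. *)
Lemma exists_side_formulas na nb (Delta : fset_Delta M) r m theta mz q :
  (forall m q, In (m, q) Delta -> fbound (na + (nb + m)) q) ->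
  fbound (na + (nb + m)) theta -> fbound (na + (nb + mz)) q ->
  let T x z w := tree x Delta nb r (fun y => sat M (x ++ y ++ w) theta /\ sat M (x ++ y ++ z) q) in
  (exists psi, fbound (na + (mz + m)) psi /\
    forall x z w, length x = na -> length z = mz -> length w = m ->
      (sat M (x ++ z ++ w) psi <-> T x z w)) /\
  (exists theta', fbound (na + (nb + (mz + m))) theta' /\
    forall x y z w, length x = na -> length y = nb -> length z = mz -> length w = m ->
      (sat M (x ++ y ++ z ++ w) theta' <->
       (sat M (x ++ y ++ w) theta /\ sat M (x ++ y ++ z) q) /\ ~ T x z w)).
Proof.
  intros HD Hth Hq T. set (B := fun _ : M => True).
  assert (HDB : forall m q, In (m, q) Delta -> fbound (na + (nb + m)) q /\ fparams B q).
  { intros m' q' Hin. split; [eauto|apply fparams_True]. }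
  assert (Hcomp : forall k p k' f, fbound k' p -> dfun B k k' f -> defn B k (fun r => sat M (f r) p)).
  { intros k p k' f Hp Hf. apply defn_comp with (P := fun r => sat M r p) (k' := k'); [|exact Hf].
    apply defn_sat; [exact Hp|apply fparams_True]. }
  assert (HT : defn B (na + (mz + m))
    (fun r => T (firstn na r) (firstn mz (skipn na r)) (skipn mz (skipn na r)))).
  { apply (@defn_tree B nb na Delta r HDB (na + (mz + m)) (fun r => firstn na r)
      (fun r y => sat M (firstn na r ++ y ++ skipn mz (skipn na r)) theta /\
                  sat M (firstn na r ++ y ++ firstn mz (skipn na r)) q)); [dfun_tac|].
    apply defn_and.
    - apply Hcomp with (k' := na + (nb + m))
        (f := fun r => firstn na (skipn nb r) ++ firstn nb r ++ skipn mz (skipn na (skipn nb r)));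
        [exact Hth|dfun_tac].
    - apply Hcomp with (k' := na + (nb + mz))
        (f := fun r => firstn na (skipn nb r) ++ firstn nb r ++ firstn mz (skipn na (skipn nb r)));
        [exact Hq|dfun_tac]. }
  split.
  - destruct HT as (psi & Hb & _ & Hs). exists psi. split; [exact Hb|].
    intros x z w Hx Hz Hw. rewrite Hs by (rewrite !length_app; lia).
    rewrite (skipn_app_eq x), (firstn_app_eq x), (skipn_app_eq z), (firstn_app_eq z) by assumption.
    reflexivity.
  - assert (HT' : defn B (na + (nb + (mz + m))) (fun r =>
      T (firstn na r) (firstn mz (skipn nb (skipn na r))) (skipn mz (skipn nb (skipn na r))))).
    { eapply defn_ext; [|apply (@defn_comp B (na + (nb + (mz + m))) (na + (mz + m)) _
        (fun r => firstn na r ++ skipn nb (skipn na r)) HT); dfun_tac].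
      intros rho Hr. cbv beta.
      rewrite firstn_app_eq, skipn_app_eq by (rewrite length_firstn; lia). reflexivity. }
    assert (H1 : defn B (na + (nb + (mz + m))) (fun r =>
      sat M (firstn na r ++ firstn nb (skipn na r) ++ skipn mz (skipn nb (skipn na r))) theta)).
    { apply Hcomp with (k' := na + (nb + m)) (f := fun r =>
        firstn na r ++ firstn nb (skipn na r) ++ skipn mz (skipn nb (skipn na r)));
        [exact Hth|dfun_tac]. }
    assert (H2 : defn B (na + (nb + (mz + m))) (fun r =>
      sat M (firstn na r ++ firstn nb (skipn na r) ++ firstn mz (skipn nb (skipn na r))) q)).
    { apply Hcomp with (k' := na + (nb + mz)) (f := fun r =>
        firstn na r ++ firstn nb (skipn na r) ++ firstn mz (skipn nb (skipn na r)));
        [exact Hq|dfun_tac]. }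
    destruct (defn_and (defn_and H1 H2) (defn_not HT')) as (f & Hb & _ & Hf).
    exists f. split; [exact Hb|]. intros x y z w Hx Hy Hz Hw.
    rewrite Hf by (rewrite !length_app; lia).
    rewrite (skipn_app_eq x), (firstn_app_eq x), (skipn_app_eq y), (firstn_app_eq y),
      (skipn_app_eq z), (firstn_app_eq z) by assumption.
    reflexivity.
Qed.

(** Equivalently, Shelah's 2-rank of [p] with respect to each finite [Delta] is finite, the bound
    being attained by one formula of [p]. *)
Definition stable (nx : nat) (p : ptype M) : Prop :=
  forall Delta, wf_Delta nx Delta ->
    exists u, p u /\ exists s, ~ tree [] Delta nx s (fun x => sat M x u).

(** The formula [theta] varies in the induction because the discarded points are described with the
    node [z] as extra parameter. For the same reason [u] and [h] have to be uniform in [w]. *)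
Lemma fibre_tree_bound (p : ptype M) na nb (Delta : fset_Delta M) :
  stable na p -> p FTrue -> (forall u v, p u -> p v -> p (FAnd u v)) ->
  (forall m q, In (m, q) Delta -> fbound (na + (nb + m)) q) ->
  forall r m theta, fbound (na + (nb + m)) theta ->
  exists u h, p u /\ forall w, length w = m ->
    (forall x, length x = na -> ~ tree x Delta nb r (fun y => sat M (x ++ y ++ w) theta)) ->
    ~ tree [] Delta (na + nb) h (fun c => sat M (firstn na c) u /\ sat M (c ++ w) theta).
Proof.
  intros Hst HpT Hpand HD. induction r as [|r IH]; intros m theta Hth.
  (* A fibre without a tree of height 0 is empty, so no point satisfies [theta] at all. *)
  { exists FTrue, 0. split; [exact HpT|]. intros w Hw Hno (c & Hc & _ & Hs).
    apply (Hno (firstn na c)); [rewrite length_firstn; lia|].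
    exists (skipn na c). split; [rewrite length_skipn; lia|].
    now rewrite app_assoc, firstn_skipn. }
  set (T := fun q x z w =>
    tree x Delta nb r (fun y => sat M (x ++ y ++ w) theta /\ sat M (x ++ y ++ z) q)).
  (* On the points lying on the side [q] of [z] whose fibre has no tree of height [r] on that
     side, the induction hypothesis bounds the trees. *)
  set (thin := fun mz q u h => forall z w, length z = mz -> length w = m ->
    ~ tree [] Delta (na + nb) h (fun c => sat M (firstn na c) u /\
        (sat M (c ++ w) theta /\ sat M (c ++ z) q) /\ ~ T q (firstn na c) z w)).
  assert (Hthin : forall mz q, fbound (na + (nb + mz)) q -> exists u h, p u /\ thin mz q u h).
  { intros mz q Hq.
    destruct (@exists_side_formulas na nb Delta r m theta mz q HD Hth Hq)
      as (_ & theta' & Hb & Hs).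
    destruct (IH (mz + m) theta' Hb) as (u & h & Hu & Hh). exists u, h. split; [exact Hu|].
    intros z w Hz Hw Ht. apply (Hh (z ++ w)).
    - rewrite length_app. lia.
    (* A tree of height [r] among the discarded points over [x] would witness [T], which any of its
       points denies. *)
    - intros x Hx Htx.
      assert (HT : T q x z w).
      { revert Htx. apply tree_sub. intros y Hy H. now apply Hs in H. }
      apply tree_nonempty in Htx as (y & Hy & H). apply Hs in H; auto. tauto.
    - revert Ht. apply tree_sub. intros c Hc (H1 & [H2 H3] & H4). split; [exact H1|].
      rewrite <- (firstn_skipn na c) in H2, H3 |- *. rewrite <- app_assoc in H2, H3 |- *.
      apply Hs; auto; [rewrite length_firstn; lia|rewrite length_skipn; lia]. }
  assert (Hmono : forall mz q u u' h h', h <= h' -> (forall c, sat M c u' -> sat M c u) ->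
    thin mz q u h -> thin mz q u' h').
  { intros mz q u u' h h' Hh Hu H z w Hz Hw Ht. apply (H z w Hz Hw).
    apply tree_anti with (t := h) in Ht; [|exact Hh]. revert Ht.
    apply tree_sub. intros c _ [H1 H2]. auto. }
  (* One [u] and one [h] for both sides of all formulas: conjunctions and sums over the finite
     [Delta]. The negative side of [q] is treated as the positive side of [FNot q]. *)
  assert (Hall : exists u h, p u /\
    forall mz q, In (mz, q) Delta -> thin mz q u h /\ thin mz (FNot q) u h).
  { assert (Hsub : forall Del, incl Del Delta -> exists u h, p u /\
      forall mz q, In (mz, q) Del -> thin mz q u h /\ thin mz (FNot q) u h).
    { induction Del as [|[mz q] Del IHD]; intros Hincl.
      - exists FTrue, 0. split; [exact HpT|]. intros ? ? [].
      - destruct IHD as (u0 & h0 & Hu0 & H0); [intros d Hd; apply Hincl; now right|].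
        assert (Hq := HD _ _ (Hincl _ (or_introl eq_refl))).
        destruct (Hthin mz q Hq) as (u1 & h1 & Hu1 & H1).
        destruct (Hthin mz (FNot q) Hq) as (u2 & h2 & Hu2 & H2).
        exists (FAnd u0 (FAnd u1 u2)), (h0 + (h1 + h2)). split; [auto|].
        intros mz' q' [E|Hin].
        + injection E as <- <-. split; [revert H1|revert H2]; apply Hmono; simpl; try tauto; lia.
        + destruct (H0 _ _ Hin) as [H3 H4]. split; [revert H3|revert H4]; apply Hmono;
            simpl; try tauto; lia. }
    apply Hsub, incl_refl. }
  destruct Hall as (u1 & h & Hu1 & Hh).
  destruct (@exists_image _ _ (fun d e : nat * formula L M => fst e = fst d + m /\
      fbound (na + fst e) (snd e) /\ forall x z w, length x = na -> length z = fst d ->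
        length w = m -> (sat M (x ++ z ++ w) (snd e) <-> T (snd d) x z w)) Delta)
    as (Psi & HPsi1 & HPsi2).
  { intros [mz q] Hin.
    destruct (@exists_side_formulas na nb Delta r m theta mz q HD Hth (HD _ _ Hin))
      as ((psi & Hb & Hs) & _).
    exists (mz + m, psi). simpl. auto. }
  destruct (Hst Psi) as (u2 & Hu2 & s & Hs).
  { intros mz q Hin. destruct (HPsi1 _ Hin) as (_ & _ & _ & Hb & _). exact Hb. }
  (* Each level of the projected tree costs one node over [theta] and [h] levels for discarding thin
     points; trees of [Psi] stop below height [s]. *)
  exists (FAnd u1 u2), (s * S h). split; [auto|]. intros w Hw Hno Ht.
  assert (Hgen : forall s (V : list M -> Prop), (forall x, V x -> sat M x u1) ->
    tree [] Delta (na + nb) (s * S h) (fun c => V (firstn na c) /\ sat M (c ++ w) theta) ->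
    tree [] Psi na s V).
  { clear s Hs Ht. induction s as [|s IHs]; intros V HV Ht.
    - destruct Ht as (c & Hc & Hc1 & _). exists (firstn na c).
      split; [rewrite length_firstn; lia|exact Hc1].
    - replace (S s * S h) with (S (h + s * S h)) in Ht by lia.
      destruct Ht as ([mz q] & Hin & z & Hz & H1 & H0). simpl in Hz, H1, H0.
      destruct (HPsi2 _ Hin) as ([mp psi] & Hpin & Emp & _ & Hpsi). simpl in Emp, Hpsi.
      destruct (Hh _ _ Hin) as [Hthin1 Hthin0].
      exists (mp, psi). split; [exact Hpin|]. exists (z ++ w).
      split; [simpl; rewrite length_app; lia|]. simpl. split; apply IHs.
      + intros x [Hx _]. auto.
      (* The first set is the thin part of this side and has no tree of height [h]; on the remaining
         points [T] holds, that is [psi]. *)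
      + apply tree_union with
          (S1 := fun c => sat M (firstn na c) u1 /\
             (sat M (c ++ w) theta /\ sat M (c ++ z) q) /\ ~ T q (firstn na c) z w)
          (S2 := fun c => (V (firstn na c) /\ sat M (firstn na c ++ z ++ w) psi) /\
             sat M (c ++ w) theta) in H1.
        * destruct H1 as [H1|H1]; [|exact H1]. now apply Hthin1 in H1.
        * intros c Hc [[Hc1 Hc2] Hc3].
          assert (Hl : length (firstn na c) = na) by (rewrite length_firstn; lia).
          rewrite (Hpsi _ z w Hl Hz Hw).
          destruct (classic (T q (firstn na c) z w)); auto.
      + intros x [Hx _]. auto.
      + apply tree_union with
          (S1 := fun c => sat M (firstn na c) u1 /\
             (sat M (c ++ w) theta /\ sat M (c ++ z) (FNot q)) /\ ~ T (FNot q) (firstn na c) z w)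
          (S2 := fun c => (V (firstn na c) /\ ~ sat M (firstn na c ++ z ++ w) psi) /\
             sat M (c ++ w) theta) in H0.
        * destruct H0 as [H0|H0]; [|exact H0]. now apply Hthin0 in H0.
        * intros c Hc [[Hc1 Hc2] Hc3].
          assert (Hl : length (firstn na c) = na) by (rewrite length_firstn; lia).
          rewrite (Hpsi _ z w Hl Hz Hw).
          (* trees of height [r] on both sides would give one of height [r + 1] *)
          destruct (classic (T (FNot q) (firstn na c) z w)) as [HT0|]; [right|left; auto].
          repeat split; auto. intros HT1. apply (Hno _ Hl).
          exists (mz, q). split; [exact Hin|]. exists z. split; [exact Hz|].
          split; [exact HT1|exact HT0]. }
  apply Hs. apply (Hgen s (fun x => sat M x u1 /\ sat M x u2)) in Ht; [|tauto].
  revert Ht. apply tree_sub. tauto.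
Qed.

(** * Subadditivity *)

(** Elements of [e] outside [B] are replaced by variables pointing to a position where they occur in
    [e]; elements of [B] stay parameters. *)
Lemma abstract_parameters (B : M -> Prop) k e (p : formula L M) :
  fbound k p -> fparams (fun v => B v \/ In v e) p ->
  exists q, fbound (k + length e) q /\ fparams B q /\
    forall rho, length rho = k -> (sat M (rho ++ e) q <-> sat M rho p).
Proof.
  intros Hb Hp.
  destruct (choice (fun x x' => atom_in k (fun v => B v \/ In v e) x ->
    atom_in (k + length e) B x' /\
    forall rho, length rho = k -> aval (rho ++ e) x' = aval rho x)) as [s Hs].
  { intros [i|v].
    - exists (inl i). simpl. intros Hi. split; [lia|].
      intros rho Hr. apply nth_error_app1. lia.
    - destruct (classic (B v)) as [HB|HB].
      + exists (inr v). simpl. auto.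
      + destruct (classic (In v e)) as [Hv|Hv].
        * apply In_nth_error in Hv as [j Hj]. exists (inl (k + j)). intros _. simpl. split.
          -- enough (j < length e) by lia. apply nth_error_Some. congruence.
          -- intros rho Hr. rewrite nth_error_app2 by lia.
             now replace (k + j - length rho) with j by lia.
        * exists (inr v). simpl. tauto. }
  destruct (@fmap_in L M p s k (fun v => B v \/ In v e) (k + length e) B) as [Hqb Hqp]; auto.
  { intros x Hx. now apply Hs. }
  exists (fmap s p). split; [exact Hqb|]. split; [exact Hqp|]. intros rho Hr.
  apply sat_fmap with (n := k) (B := fun v => B v \/ In v e); auto.
  intros x Hx. now apply Hs.
Qed.

(** Parameters of the formulas move into the tuples of the instances. [Delta] may have parameters
    anywhere, while the bound on its trees has to come from a formula over [A]. *)
Lemma exists_pfree_Delta nx (Delta : fset_Delta M) : wf_Delta nx Delta ->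
  exists Delta', (forall m q, In (m, q) Delta' -> fbound (nx + m) q /\ pfree M q) /\
    forall s S, tree [] Delta nx s S -> tree [] Delta' nx s S.
Proof.
  intros Hwf.
  destruct (@exists_image _ _ (fun d d' : nat * formula L M =>
      (fbound (nx + fst d') (snd d') /\ pfree M (snd d')) /\
      exists e, fst d' = fst d + length e /\ forall c, length c = nx + fst d ->
        (sat M (c ++ e) (snd d') <-> sat M c (snd d))) Delta) as (Delta' & H1 & H2).
  { intros [m q] Hin. destruct (fparams_finite q) as [e He].
    destruct (@abstract_parameters (fun _ => False) (nx + m) e q) as (q' & Hb & Hp & Hs).
    - auto.
    - revert He. apply fparams_mono. auto.
    - exists (m + length e, q'). simpl. rewrite Nat.add_assoc. eauto. }
  exists Delta'. split.
  - intros m q Hin. destruct (H1 _ Hin) as (_ & _ & H & _). exact H.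
  - intros s S. apply tree_mono; [|auto]. intros m q z Hin Hz.
    destruct (H2 _ Hin) as ([m' q'] & Hin' & _ & e & Em & Hs). simpl in Em, Hs.
    exists m', q', (z ++ e). split; [exact Hin'|]. split; [rewrite length_app; lia|].
    intros c Hc. simpl. rewrite (app_assoc c z e). symmetry. apply Hs.
    rewrite length_app. lia.
Qed.

(** If no formula of the type bounds the heights for [Delta], then no finite part does, because its
    conjunction belongs to the type. *)
Lemma ample_or_stable c (B : M -> Prop) :
  (exists Delta, wf_Delta (length c) Delta /\
     ample Delta (length c) (tp M c B) (fun _ => True)) \/
  stable (length c) (tp M c B).
Proof.
  destruct (classic (stable (length c) (tp M c B))) as [|Hn]; [now right|left].
  apply NNPP. intros Hno. apply Hn. intros Delta Hwf. apply NNPP. intros Hu.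
  apply Hno. exists Delta. split; [exact Hwf|]. intros l s Hl. apply NNPP. intros Ht.
  apply Hu. exists (bigand l). split.
  - destruct (@bigand_in (length c) B l); [intros p Hp; split; apply (Hl p Hp)|].
    split; [auto|]. split; [auto|]. apply sat_bigand. intros p Hp. apply (Hl p Hp).
  - exists s. intros H. apply Ht. revert H. apply tree_sub.
    intros x _ Hx. split; [|exact I]. now apply sat_bigand.
Qed.

(** The type of [b] gives [theta(y, a)] whose fibre over [a] has no tree of height [r]. Having no
    such tree is definable over [A], so it defines a set [X] in the type of [a], over which
    [fibre_tree_bound] applies. *)
Lemma stable_app (a b : list M) (A : M -> Prop) (Delta : fset_Delta M) :
  stable (length a) (tp M a A) -> stable (length b) (tp M b (fun v => A v \/ In v a)) ->
  wf_Delta (length (a ++ b)) Delta ->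
  exists v s, tp M (a ++ b) A v /\
    ~ tree [] Delta (length (a ++ b)) s (fun c => sat M c v).
Proof.
  rewrite length_app. set (na := length a). set (nb := length b). intros Ha Hb Hwf0.
  destruct (exists_pfree_Delta Hwf0) as (Del & HDel & HDtree).
  enough (exists v s, tp M (a ++ b) A v /\ ~ tree [] Del (na + nb) s (fun c => sat M c v))
    as (v & s & Hv & Hn) by (exists v, s; split; auto).
  clear Delta Hwf0 HDtree.
  assert (HDA : forall m q, In (m, q) Del -> fbound (na + (nb + m)) q /\ fparams A q).
  { intros m q Hin. destruct (HDel m q Hin) as [H1 H2]. rewrite Nat.add_assoc.
    split; [exact H1|]. revert H2. apply fparams_mono. tauto. }
  (* With [a] put in the first coordinates, trees over the prefix [a] become trees with empty
     prefix. *)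
  destruct (@exists_image _ _ (fun d d' : nat * formula L M => fst d' = fst d /\
      fbound (nb + fst d') (snd d') /\ forall y, length y = nb + fst d ->
        (sat M y (snd d') <-> sat M (a ++ y) (snd d))) Del) as (Dela & H1 & H2).
  { intros [m q] Hin. destruct (@defn_comp (fun _ => True) (nb + m) (na + (nb + m))
      (fun r => sat M r q) (fun r => a ++ r)) as (q' & Hq1 & _ & Hq2).
    - apply defn_sat; [apply (HDA m q Hin)|apply fparams_True].
    - eapply dfun_app; [apply dfun_const; auto|apply dfun_id|reflexivity].
    - exists (m, q'). simpl. auto. }
  destruct (Hb Dela) as (u & (Hub & Hup & Hus) & r & Hr).
  { intros m q Hin. destruct (H1 _ Hin) as (_ & _ & _ & H & _). exact H. }
  destruct (@abstract_parameters A nb a u Hub Hup) as (theta & Htb & Htp & Hts).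
  fold na in Htb.
  set (X := fun x => ~ tree x Del nb r (fun y => sat M (y ++ x) theta)).
  assert (HX : defn A na X).
  { apply defn_not. apply (@defn_tree A nb na Del r HDA na (fun x => x)
      (fun x y => sat M (y ++ x) theta)); [apply dfun_id|].
    apply defn_comp with (P := fun r => sat M r theta) (k' := nb + na)
      (f := fun r => firstn nb r ++ skipn nb r); [apply defn_sat; auto|dfun_tac]. }
  assert (HXa : X a).
  { intros Ht. apply Hr. revert Ht. apply tree_mono.
    - intros m q z Hin Hz. destruct (H2 _ Hin) as ([m' q'] & Hin' & Em & _ & Hq).
      simpl in Em, Hq. subst m'. exists m, q', z. split; [exact Hin'|]. split; [exact Hz|].
      intros y Hy. simpl. symmetry. apply Hq. rewrite length_app. lia.
    - intros y Hy. now apply Hts. }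
  (* Intersecting with [X] empties the fibres outside [X]. The summand 0 is the length of the empty
     tuple [w]; [theta] takes [y] before [x], as [a] was abstracted to the end. *)
  assert (HTh : defn A (na + (nb + 0)) (fun c => X (firstn na c) /\
    sat M (skipn na c ++ firstn na c) theta)).
  { apply defn_and.
    - apply defn_comp with (P := X) (k' := na) (f := fun c => firstn na c); [exact HX|dfun_tac].
    - apply defn_comp with (P := fun r => sat M r theta) (k' := nb + na)
        (f := fun c => skipn na c ++ firstn na c); [apply defn_sat; auto|dfun_tac]. }
  destruct HTh as (Theta & HT1 & HT2 & HT3).
  destruct (@fibre_tree_bound (tp M a A) na nb Del Ha) with (r := r) (m := 0) (theta := Theta)
    as (v & h & (Hvb & Hvp & Hvs) & Hh).
  - repeat split.
  - intros p q (? & ? & ?) (? & ? & ?). repeat split; auto.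
  - intros m q Hin. apply (HDA m q Hin).
  - exact HT1.
  - assert (Hfin : defn A (na + nb) (fun c => sat M (firstn na c) v /\ sat M c Theta)).
    { apply defn_and.
      - apply defn_comp with (P := fun c => sat M c v) (k' := na) (f := fun c => firstn na c);
          [apply defn_sat; auto|dfun_tac].
      - apply defn_sat; [|exact HT2]. now rewrite Nat.add_0_r in HT1. }
    destruct Hfin as (f & Hf1 & Hf2 & Hf3). exists f, h. split.
    + unfold tp. rewrite length_app. split; [exact Hf1|]. split; [exact Hf2|].
      apply Hf3; [apply length_app|].
      rewrite firstn_app_eq by reflexivity. split; [exact Hvs|].
      apply HT3; [rewrite length_app; unfold na, nb; lia|].
      rewrite firstn_app_eq, skipn_app_eq by reflexivity. split; [exact HXa|].
      now apply Hts.
    + intros Ht. apply (Hh [] eq_refl).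
      (* A tree has a point, which puts [x] in [X], where trees of height [r] are excluded. *)
      * intros x Hx Hx'.
        assert (Hsat : forall y, length y = nb ->
          (sat M (x ++ y ++ []) Theta <-> X x /\ sat M (y ++ x) theta)).
        { intros y Hy. rewrite app_nil_r, HT3 by (rewrite length_app; lia).
          now rewrite firstn_app_eq, skipn_app_eq by exact Hx. }
        destruct (tree_nonempty _ _ _ _ _ Hx') as (y & Hy & Hxy). apply Hsat in Hxy; [|exact Hy].
        apply (proj1 Hxy). revert Hx'. apply tree_sub. intros y' Hy' H. now apply Hsat.
      * revert Ht. apply tree_sub. intros c Hc H. rewrite app_nil_r. now apply Hf3.
Qed.

(** * The value of op-dimension *)

Lemma is_sup_exists (P : nat -> Prop) : exists d, is_sup P d.
Proof.
  destruct (classic (exists N, forall k, P k -> k <= N)) as [[N HN]|Hno].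
  - induction N as [|N IH].
    + exists (Some 0). split; [exact HN|]. intros [e|] _; simpl; [lia|exact I].
    + destruct (classic (P (S N))) as [HP|HP].
      * exists (Some (S N)). split; [exact HN|]. intros e He. apply (He _ HP).
      * apply IH. intros k Hk. specialize (HN k Hk).
        destruct (Nat.eq_dec k (S N)) as [->|]; [contradiction|lia].
  - exists None. split; [exact (fun _ _ => I)|]. intros [e|] He; simpl; [|exact I].
    apply Hno. exists e. exact He.
Qed.

Lemma opD_is_sup nx (pi : ptype M) : is_sup (opD_set nx pi) (opD nx pi).
Proof. unfold opD. apply epsilon_spec, is_sup_exists. Qed.

Lemma ample_opD (K : Type) (B : M -> Prop) c Delta :
  monster M K -> small M K B -> wf_Delta (length c) Delta ->
  ample Delta (length c) (tp M c B) (fun _ => True) -> opD_tp M c B = None.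
Proof.
  intros (_ & He & _ & Hsat & _) HB Hwf HA.
  destruct (opD_is_sup (length c) (tp M c B)) as [Hub _]. unfold opD_tp.
  destruct (opD (length c) (tp M c B)) as [d|]; [exfalso|reflexivity].
  enough (H : S d <= d) by lia. apply (Hub (S d)). split; [lia|].
  apply (@ample_opR_inf K B (length c) Delta (tp M c B)); auto.
  intros p (H1 & H2 & _). auto.
Qed.
End Evaluation.

Theorem theorem2p2 (L : language) (M : structure L) (K : Type)
  (Hmon : monster M K) (Hnip : NIP M)
  (A : M -> Prop) (HA : small M K A) (a b : list M) :
  enat_le (opD_tp M (a ++ b) A)
          (enat_add (opD_tp M a A) (opD_tp M b (fun v => A v \/ In v a))).
Proof.
  (* An infinite tree in either type on the right makes the sum omega; otherwise both types are
     stable. *)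
  destruct (ample_or_stable M a A) as [(Delta & Hwf & Ha)|Ha].
  { rewrite (ample_opD Hmon HA Hwf Ha). simpl. destruct (opD_tp M (a ++ b) A); exact I. }
  destruct (ample_or_stable M b (fun v => A v \/ In v a)) as [(Delta & Hwf & Hb)|Hb].
  { assert (HAa : small M K (fun v => A v \/ In v a)) by (apply small_list; [apply Hmon|exact HA]).
    rewrite (ample_opD Hmon HAa Hwf Hb).
    destruct (opD_tp M a A), (opD_tp M (a ++ b) A); exact I. }
  (* By the least upper bound property it suffices to refute every [k] in the set: it would give
     trees of all finite heights, obtained from the rank along [nat] with [lt], against the bound of
     [stable_app]. *)
  unfold opD_tp at 1. apply (opD_is_sup (length (a ++ b)) (tp M (a ++ b) A)).
  intros k (Hk & Delta & Hwf & HR). exfalso.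
  destruct (stable_app Ha Hb Hwf) as (v & s & Hv & Hn). apply Hn.
  generalize (rank_ge_tree Hk Hwf (HR nat lt Wf_nat.lt_wf s) [v]).
  intros Ht. generalize (Ht ltac:(intros p [<-|[]]; exact Hv)). apply tree_sub.
  intros c _ H. apply H. now left.
Qed.
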